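(* The following identities hold: (a) $F_{\{123,132,213\}}=\frac{1+xz+(x^2-q)z^2+(-xq+q^2+q)z^3-x^2qz^4}{(1+qz^2)(1-3qz^2+q^2z^4)}$; (b) $F_{\{231,312,321\}}=\frac{1}{1-xz-qz^2}$; (c) $F_{\{123,132,231\}}=F_{\{123,213,231\}}=\frac{1+xz+(x^2-q)z^2+qz^3+(-x^2q+xq+q^2)z^4}{(1-qz^2)^2}$; (c') $F_{\{123,132,312\}}=F_{\{123,213,312\}}=\frac{1+xz+(x^2-q)z^2+q^2z^3+(-x^2q+xq^2+q^2)z^4}{(1-qz^2)^2}$; (d) $F_{\{132,231,321\}}=F_{\{213,231,321\}}=\frac{1-z+qz^2}{(1-z)(1-xz)}$; (d') $F_{\{132,312,321\}}=F_{\{213,312,321\}}=\frac{1-qz+qz^2}{(1-xz)(1-qz)}$; (e) $F_{\{132,213,231\}}=\frac{1-z-qz^2+2qz^3+(-x^2q+q^2-xq)z^4+(x^2q-2q^2)z^5+xq^2z^6}{(1-z)(1-xz)(1-qz^2)^2}$; (e') $F_{\{132,213,312\}}=\frac{1-qz-qz^2+2q^2z^3+(-x^2q-xq^2+q^2)z^4+(x^2q^2-2q^3)z^5+xq^3z^6}{(1-xz)(1-qz)(1-qz^2)^2}$; (f) $F_{\{132,231,312\}}=F_{\{213,231,312\}}=\frac{1+xqz^3}{(1-xz)(1-qz^2)}$; (g) $F_{\{123,231,312\}}=\frac{1+xz+(x^2-q)z^2+xqz^3+q^2z^4}{(1-qz^2)^2}$; (h) $F_{\{132,213,321\}}=\frac{1-(1+q)z+2qz^2-xqz^3}{(1-z)(1-xz)(1-qz)}$;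 (i) $F_{\{123,132,321\}}=F_{\{123,213,321\}}=1+xz+(x^2+q)z^2+(xq+q^2+q)z^3+q^2z^4$; (j) $F_{\{123,231,321\}}=1+xz+(x^2+q)z^2+(2xq+q)z^3+q^2z^4$; (j') $F_{\{123,312,321\}}=1+xz+(x^2+q)z^2+(2xq+q^2)z^3+q^2z^4$; where every $F_\Sigma$ is evaluated at $(x,q,z)$.
   Context: For permutations $\pi=\pi_1\cdots\pi_n\in\mathfrak{S}_n$ and $\sigma\in\mathfrak{S}_m$, $\pi$ contains $\sigma$ if there are indices $i_1<\dots<i_m$ such that $\pi_{i_1}\cdots\pi_{i_m}$ is in the same relative order as $\sigma$; otherwise $\pi$ avoids $\sigma$. For a set $\Sigma$ of patterns, $\mathfrak{S}_n(\Sigma)$ is the set of permutations in $\mathfrak{S}_n$ avoiding every pattern in $\Sigma$. $\mathrm{fp}(\pi)=|\{i:\pi_i=i\}|$, $\mathrm{exc}(\pi)=|\{i:\pi_i>i\}|$, and $F_\Sigma(x,q,z)=\sum_{n\ge0}\sum_{\pi\in\mathfrak{S}_n(\Sigma)}x^{\mathrm{fp}(\pi)}q^{\mathrm{exc}(\pi)}z^n$ ($\mathfrak{S}_0$ contains only the empty permutation). *)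

(* Defs.v *)
From HB Require Import structures.
From mathcomp Require Import all_boot all_fingroup all_algebra.
From mathcomp Require Import mpoly.

Set Implicit Arguments.
Unset Strict Implicit.
Unset Printing Implicit Defensive.

Import GRing.Theory.
Local Open Scope ring_scope.

(* Permutations of {1, ..., n} are elements of 'S_n, acting on {0, ..., n-1}:
   all positions and values are shifted down by one, which changes neither
   relative orders nor the comparisons of pi_i with i. *)

Section Statistics.
Variable n : nat.
Implicit Type pi : 'S_n.

Definition fp pi : nat := #|[set i | pi i == i]|.

Definition exc pi : nat := #|[set i : 'I_n | (i < pi i)%N]|.

Definition contains (m : nat) pi (sigma : 'S_m) : bool :=
  [exists f : {ffun 'I_m -> 'I_n},
    [forall i : 'I_m, [forall j : 'I_m, (i < j)%N ==> (f i < f j)%N]] &&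
    [forall i : 'I_m, [forall j : 'I_m,
      (pi (f i) < pi (f j))%N == (sigma i < sigma j)%N]]].

Definition avoids (m : nat) pi (Sigma : {set 'S_m}) : bool :=
  [forall sigma in Sigma, ~~ contains pi sigma].

End Statistics.

(* The permutation with one-line notation w, written with values 1, ..., n.+1
   (the identity if w is not the one-line notation of a permutation). *)
Definition oneline (n : nat) (w : seq nat) : 'S_n.+1 :=
  insubd (1%g : 'S_n.+1) [ffun i : 'I_n.+1 => inord (nth 0%N w i).-1].

Lemma onelineE n w (i : 'I_n.+1) :
  perm_eq w (iota 1 n.+1) -> (oneline n w i).+1 = nth 0%N w i.
Proof.
move=> w_perm; have sz_w : size w = n.+1 by rewrite (perm_size w_perm) size_iota.
have bnd (j : 'I_n.+1) : (0 < nth 0%N w j <= n.+1)%N.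
  have: nth 0%N w j \in w by rewrite mem_nth ?sz_w.
  by rewrite (perm_mem w_perm) mem_iota add1n ltnS.
pose g := [ffun i : 'I_n.+1 => inord (nth 0%N w i).-1 : 'I_n.+1].
have gE j : (g j).+1 = nth 0%N w j.
  by have /andP[p0 pn] := bnd j; rewrite ffunE inordK prednK.
have g_inj : injectiveb g.
  apply/injectiveP => j k /(congr1 (fun l : 'I_n.+1 => (val l).+1)) /=.
  rewrite !gE => /eqP; rewrite nth_uniq ?sz_w //; first by move=> /eqP/val_inj.
  by rewrite (perm_uniq w_perm) iota_uniq.
rewrite /oneline -/g -gE; congr (_.+1); congr (val _).
have -> : insubd (1%g : 'S_n.+1) g = Perm g_inj by rewrite /insubd insubT.
by rewrite unlock.
Qed.

Definition p123 : 'S_3 := oneline 2 [:: 1; 2; 3]%N.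
Definition p132 : 'S_3 := oneline 2 [:: 1; 3; 2]%N.
Definition p213 : 'S_3 := oneline 2 [:: 2; 1; 3]%N.
Definition p231 : 'S_3 := oneline 2 [:: 2; 3; 1]%N.
Definition p312 : 'S_3 := oneline 2 [:: 3; 1; 2]%N.
Definition p321 : 'S_3 := oneline 2 [:: 3; 2; 1]%N.

(* Power series in z over Z[x, q] are given by their coefficient sequences;
   'X_0 and 'X_1 are the indeterminates x and q. *)
Definition F (m : nat) (Sigma : {set 'S_m}) : nat -> {mpoly int[2]} :=
  fun n => \sum_(pi : 'S_n | avoids pi Sigma) 'X_0 ^+ fp pi * 'X_1 ^+ exc pi.

Section RationalSeries.
Variable R : comNzRingType.
Implicit Types (P Q : {poly R}) (f : nat -> R).

(* The power series P / Q, for Q with constant coefficient 1: then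
   1 / Q = \sum_k (1 - Q)^k, and the terms with k > n do not contribute to
   the coefficient of 'X^n. *)
Definition ratseries P Q : nat -> R :=
  fun n => (P * \sum_(k < n.+1) (1 - Q) ^+ k)`_n.

Lemma ratseriesP P Q f : Q`_0 = 1 ->
  (f =1 ratseries P Q) <->
  (forall n, \sum_(i < n.+1) Q`_i * f (n - i)%N = P`_n).
Proof.
move=> Q0.
have [U defU] : exists U : {poly R}, 1 - Q = U * 'X.
  exists (\poly_(i < size Q) - Q`_i.+1); apply/polyP => -[|i].
    by rewrite coefMX coefB coef1 Q0 subrr.
  rewrite coefMX coefB coef1 sub0r coef_poly; case: ltnP => //= leQi.
  by rewrite nth_default ?oppr0 // (leq_trans leQi).
have small (A : {poly R}) k n : (n < k)%N -> (A * (1 - Q) ^+ k)`_n = 0.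
  by move=> ltnk; rewrite defU exprMn mulrA coefMXn ltnk.
have rsE N n : (n < N)%N ->
    ratseries P Q n = (P * \sum_(k < N) (1 - Q) ^+ k)`_n.
  move=> ltnN; rewrite /ratseries -(subnKC ltnN) big_split_ord /= mulrDr coefD.
  rewrite -[LHS]addr0; congr (_ + _); rewrite mulr_sumr coef_sum big1 // => k _.
  by apply: small; rewrite addSn ltnS leq_addr.
have rs_sol n : \sum_(i < n.+1) Q`_i * ratseries P Q (n - i)%N = P`_n.
  have geom : Q * (\sum_(k < n.+1) (1 - Q) ^+ k) = 1 - (1 - Q) ^+ n.+1.
    have := subrXX 1 (1 - Q) n.+1; rewrite expr1n subKr => ->.
    by congr (_ * _); apply: eq_bigr => k _; rewrite expr1n mul1r.
  transitivity (Q * (P * \sum_(k < n.+1) (1 - Q) ^+ k))`_n.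
    rewrite coefM; apply: eq_bigr => i _; congr (_ * _).
    by apply: rsE; rewrite ltnS leq_subr.
  by rewrite mulrCA geom mulrBr mulr1 coefB small ?subr0.
split=> [fE n | f_sol n].
  by rewrite -rs_sol; apply: eq_bigr => i _; rewrite fE.
elim/ltn_ind: n => n IHn.
have := f_sol n; rewrite -(rs_sol n) !big_ord_recl /= Q0 !mul1r subn0.
have -> : \sum_(i < n) Q`_(bump 0 i) * f (n - bump 0 i)%N =
    \sum_(i < n) Q`_(bump 0 i) * ratseries P Q (n - bump 0 i)%N.
  apply: eq_bigr => i _; rewrite IHn //.
  by rewrite /bump /= add1n ltn_subrL /= (leq_ltn_trans _ (ltn_ord i)).
by move/addIr.
Qed.

End RationalSeries.

(* Main.v *)
Require Import Defs.
From mathcomp Require Import all_boot all_fingroup all_algebra.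
From mathcomp Require Import mpoly.
From mathcomp Require Import zify ring.

(* Give a letter v at position i the weight x, q or y according to whether v = i,
   v > i or v < i; the case y = 1 is F. Inversion and reverse-complement exchange
   q and y and permute the patterns, so that one set of patterns is enough in
   each of (c)/(c'), (d)/(d'), (e)/(e') and (f). Complementation pairs (b) with
   (a), (d) with (c), (f) with (e) and (h) with (g): each pair is described by one
   analysis of the first letter of a word, read for < and for >. The description
   gives either a linear recurrence for the weighted sums or, because a decreasing
   word of length n exceeds its positions exactly in its first half, closed forms
   at even and at odd length. In (i), (j) and (j') every word of length at least 5
   has a monotone triple. *)

Set Implicit Arguments.
Unset Strict Implicit.
Unset Printing Implicit Defensive.

Import GRing.Theory.
Local Open Scope ring_scope.

(** The weight y makes inversion usable. Inversion turns exceedances into letters below their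
    position, and these number n - fp - exc; in x and q alone it would be the substitution of x/q,
    1/q, qz for x, q, z instead of an exchange of two variables. Complementation has no comparable
    effect on the weights: it carries over the list of words only, and the two sums of a pair are
    computed by different means. A sum over words depends on the position p at which they start. If
    letters leave an increasing list from below, letters and positions both advance by one, so the
    sum does not depend on p and satisfies a recurrence in the length alone. If they leave the
    decreasing list n-1, ..., 0 from above, each step lowers n - p by two. Hence p stays as a
    parameter, the parity of n - p is an invariant that decides whether the decreasing word meets a
    fixed position, and the recursion stops once n <= p, where every letter has weight y. *)

Section Weights.
Variables (R : comNzRingType) (x q y : R).

Definition letw (i v : nat) : R :=
  if v == i then x else if (i < v)%N then q else y.

Fixpoint wordw (p : nat) (w : seq nat) : R :=
  if w is v :: w' then letw p v * wordw p.+1 w' else 1.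

Definition permw n (pi : 'S_n) : R := \prod_(i < n) letw i (pi i).

Definition Fw m (Sigma : {set 'S_m}) (n : nat) : R :=
  \sum_(pi : 'S_n | avoids pi Sigma) permw pi.

Lemma letwE i : letw i i = x. Proof. by rewrite /letw eqxx. Qed.

Lemma letw_exc i v : (i < v)%N -> letw i v = q.
Proof. by rewrite /letw => lt_iv; rewrite gtn_eqF // lt_iv. Qed.

Lemma letw_anti i v : (v < i)%N -> letw i v = y.
Proof. by rewrite /letw => lt_vi; rewrite ltn_eqF // ltnNge ltnW. Qed.

Lemma wordw_cat p u v : wordw p (u ++ v) = wordw p u * wordw (p + size u) v.
Proof.
elim: u p => [|a u IHu] p /=; first by rewrite mul1r addn0.
by rewrite IHu mulrA addSnnS.
Qed.

Lemma wordwE x0 p w :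
  wordw p w = \prod_(i < size w) letw (p + i) (nth x0 w i).
Proof.
elim: w p => [|a w IHw] p /=; first by rewrite big_ord0.
rewrite big_ord_recl addn0 IHw /=; congr (_ * _).
by apply: eq_bigr => i _; rewrite /bump /= add1n addSnnS.
Qed.

End Weights.

Lemma F_Fw m (Sigma : {set 'S_m}) n : F Sigma n = Fw 'X_0 'X_1 1 Sigma n.
Proof.
apply: eq_bigr => pi _; rewrite /permw (bigID (fun i => pi i == i)) /=.
congr (_ * _).
  rewrite /fp -prodr_const; apply: eq_big => i; rewrite inE //.
  by move/eqP->; rewrite letwE.
rewrite (bigID (fun i : 'I_n => (i < pi i)%N)) /= [X in _ * X]big1 ?mulr1.
  rewrite /exc -prodr_const; apply: eq_big => i; rewrite inE.
    by rewrite -val_eqE /=; case: ltngtP.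
  by move=> lt_ipi; rewrite letw_exc.
by move=> i /andP[neq_ipi nlt_ipi]; rewrite letw_anti // ltn_neqAle neq_ipi leqNgt.
Qed.

(** * Pattern containment, inversion and reverse-complement *)

Lemma containsP n m (pi : 'S_n) (sigma : 'S_m) :
  reflect (exists2 f : {ffun 'I_m -> 'I_n},
             forall i j : 'I_m, (i < j)%N -> (f i < f j)%N
           & forall i j, (pi (f i) < pi (f j))%N = (sigma i < sigma j)%N)
          (contains pi sigma).
Proof.
apply: (iffP existsP) => [[f /andP[/forallP fI /forallP fP]] | [f fI fP]]; exists f.
- by move=> i j; have /forallP/(_ j)/implyP := fI i.
- by move=> i j; have /forallP/(_ j)/eqP := fP i.
apply/andP; split; apply/forallP => i; apply/forallP => j.
  by apply/implyP/fI.
exact/eqP/fP.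
Qed.

Lemma incr_ltn n m (f : 'I_m -> 'I_n) :
  (forall i j : 'I_m, (i < j)%N -> (f i < f j)%N) ->
  forall i j : 'I_m, (f i < f j)%N = (i < j)%N.
Proof.
move=> fI i j; case: (ltngtP i j) => [/fI -> //|/fI lt_ji|/val_inj ->]; last by rewrite ltnn.
by rewrite ltnNge ltnW.
Qed.

Lemma containsV n m (pi : 'S_n) (sigma : 'S_m) :
  contains pi^-1 sigma^-1 = contains pi sigma.
Proof.
suff imp k l (rho : 'S_k) (tau : 'S_l) : contains rho tau -> contains rho^-1 tau^-1.
  by apply/idP/idP => /imp //; rewrite !invgK.
case/containsP => f fI fP; apply/containsP.
(* The values of an occurrence, listed in increasing order, are the positions of an occurrence in
   the inverse. *)
exists [ffun i => rho (f (tau^-1 i)%g)] => i j; rewrite !ffunE.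
  by rewrite fP !permKV.
by rewrite !permK incr_ltn.
Qed.

(** Conjugation by this involution is the reverse-complement map. *)
Definition revp n : 'S_n := perm (@rev_ord_inj n).

Lemma ltn_revp n (i j : 'I_n) : (revp n i < revp n j)%N = (j < i)%N.
Proof. by rewrite !permE /=; have := ltn_ord i; have := ltn_ord j; lia. Qed.

Lemma revpK n : involutive (revp n).
Proof. by move=> i; rewrite !permE rev_ordK. Qed.

Lemma revpJ n (pi : 'S_n) i : (pi ^ revp n)%g i = revp n (pi (revp n i)).
Proof. by rewrite -{1}[i]revpK permJ. Qed.

Lemma conj_revpK n : involutive (fun pi : 'S_n => (pi ^ revp n)%g).
Proof. by move=> pi; apply/permP => i; rewrite !revpJ !revpK. Qed.

Lemma containsJ n m (pi : 'S_n) (sigma : 'S_m) :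
  contains (pi ^ revp n)%g (sigma ^ revp m)%g = contains pi sigma.
Proof.
suff imp k l (rho : 'S_k) (tau : 'S_l) :
    contains rho tau -> contains (rho ^ revp k)%g (tau ^ revp l)%g.
  by apply/idP/idP => /imp //; rewrite !conj_revpK.
case/containsP => f fI fP; apply/containsP.
exists [ffun i => revp k (f (revp l i))] => i j; rewrite !ffunE.
  by rewrite !ltn_revp incr_ltn // ltn_revp.
by rewrite !revpJ !revpK !ltn_revp fP.
Qed.

Section Symmetries.
Variables (R : comNzRingType) (x q y : R).

Lemma letwC i j : letw x q y j i = letw x y q i j.
Proof. by rewrite /letw eq_sym; case: ltngtP. Qed.

Lemma permwV n (pi : 'S_n) : permw x q y pi^-1 = permw x y q pi.
Proof.
rewrite /permw (reindex_inj (@perm_inj _ pi)) /=.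
by apply: eq_bigr => i _; rewrite permK letwC.
Qed.

Lemma permwJ n (pi : 'S_n) : permw x q y (pi ^ revp n)%g = permw x y q pi.
Proof.
rewrite /permw (reindex_inj (@perm_inj _ (revp n))) /=.
apply: eq_bigr => i _; rewrite revpJ revpK /letw !val_eqE (inj_eq perm_inj).
by rewrite ltn_revp -val_eqE; case: ltngtP.
Qed.

Variables (m : nat) (s1 s2 s3 : 'S_m).

Lemma avoids3 n (pi : 'S_n) : avoids pi [set s1; s2; s3] =
  [&& ~~ contains pi s1, ~~ contains pi s2 & ~~ contains pi s3].
Proof.
apply/forall_inP/and3P => [av | [av1 av2 av3] s]; last first.
  by rewrite !inE => /orP[/orP[]|] /eqP->.
by split; apply: av; rewrite !inE eqxx ?orbT.
Qed.

End Symmetries.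

Lemma FwV (R : comNzRingType) (x q y : R) m (s1 s2 s3 : 'S_m) n :
  Fw x q y [set s1^-1%g; s2^-1%g; s3^-1%g] n = Fw x y q [set s1; s2; s3] n.
Proof.
rewrite /Fw (reindex_inj invg_inj); apply: eq_big => pi; last by rewrite permwV.
by rewrite !avoids3 !containsV.
Qed.

Lemma FwJ (R : comNzRingType) (x q y : R) m (s1 s2 s3 : 'S_m) n :
  Fw x q y [set s1 ^ revp m; s2 ^ revp m; s3 ^ revp m]%g n =
  Fw x y q [set s1; s2; s3] n.
Proof.
rewrite /Fw (reindex_inj (inv_inj (@conj_revpK n))).
by apply: eq_big => pi; [rewrite !avoids3 !containsJ | rewrite permwJ].
Qed.

(** * Permutations as words *)

Fixpoint tripwise (bad : nat -> nat -> nat -> bool) (w : seq nat) : bool :=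
  if w is a :: w' then pairwise (fun b c => ~~ bad a b c) w' && tripwise bad w'
  else true.

Lemma tripwiseP bad w :
  reflect (forall i j k, (i < j)%N -> (j < k)%N -> (k < size w)%N ->
             ~~ bad (nth 0%N w i) (nth 0%N w j) (nth 0%N w k))
          (tripwise bad w).
Proof.
elim: w => [|a w IHw] /=; first by constructor.
apply: (iffP andP) => [[/(pairwiseP 0%N) pw /IHw tw] [|i] [|j] [|k] //= | tw].
- by rewrite !ltnS => _ lt_jk lt_kw; apply: pw => //; apply: ltn_trans lt_kw.
- by rewrite !ltnS => lt_ij lt_jk lt_kw; apply: tw.
split; last by apply/IHw => i j k ? ? ?; apply: (tw i.+1 j.+1 k.+1).
by apply/(pairwiseP 0%N) => j k _ lt_kw lt_jk; apply: (tw 0%N j.+1 k.+1).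
Qed.

Definition pat (s : seq nat) (a b c : nat) : bool :=
  [&& (a < b)%N == (nth 0 s 0 < nth 0 s 1)%N,
      (a < c)%N == (nth 0 s 0 < nth 0 s 2)%N
    & (b < c)%N == (nth 0 s 1 < nth 0 s 2)%N].

Definition pat3 (s t u : seq nat) (a b c : nat) : bool :=
  [|| pat s a b c, pat t a b c | pat u a b c].

Section PermWord.
Variable n : nat.
Implicit Type pi : 'S_n.

Definition permword pi : seq nat := [seq val (pi i) | i <- enum 'I_n].

Lemma size_permword pi : size (permword pi) = n.
Proof. by rewrite size_map size_enum_ord. Qed.

Lemma nth_permword pi (i : 'I_n) : nth 0%N (permword pi) i = pi i.
Proof. by rewrite (nth_map i) ?nth_ord_enum // size_enum_ord. Qed.

Lemma permword_inj : injective permword.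
Proof.
by move=> pi rho eq_w; apply/permP => i; apply: ord_inj; rewrite -!nth_permword eq_w.
Qed.

Lemma permword_uniq pi : uniq (permword pi).
Proof. by rewrite map_inj_uniq ?enum_uniq // => i j /val_inj/perm_inj. Qed.

Lemma perm_eq_permword pi : perm_eq (permword pi) (iota 0 n).
Proof.
rewrite uniq_perm ?permword_uniq ?iota_uniq // => v; rewrite mem_iota /=.
apply/mapP/idP => [[i _ ->] | lt_vn]; first exact: ltn_ord.
by exists (pi^-1%g (Ordinal lt_vn)); rewrite ?mem_enum ?permKV.
Qed.

Lemma permword_surj w : perm_eq w (iota 0 n) -> exists pi, w = permword pi.
Proof.
move=> w_perm; have sz_w : size w = n by rewrite (perm_size w_perm) size_iota.
have bnd (i : 'I_n) : (nth 0%N w i < n)%N.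
  have: nth 0%N w i \in w by rewrite mem_nth ?sz_w.
  by rewrite (perm_mem w_perm) mem_iota.
have inj : injective (fun i => Ordinal (bnd i)).
  move=> i j /(congr1 val) /= /eqP.
  by rewrite nth_uniq ?sz_w // ?(perm_uniq w_perm) ?iota_uniq // => /eqP/val_inj.
exists (perm inj); apply: (@eq_from_nth _ 0%N) => [|i]; rewrite sz_w ?size_permword // => lt_in.
by rewrite (nth_permword _ (Ordinal lt_in)) permE.
Qed.

Lemma contains_oneline pi s : perm_eq s (iota 1 3) ->
  reflect (exists i j k : 'I_n, [/\ (i < j)%N, (j < k)%N & pat s (pi i) (pi j) (pi k)])
          (contains pi (oneline 2 s)).
Proof.
move=> s_perm.
have sE (a b : 'I_3) : (oneline 2 s a < oneline 2 s b)%N = (nth 0 s a < nth 0 s b)%N.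
  by rewrite -ltnS !onelineE.
apply: (iffP (containsP _ _)) => [[f fI fP] | [i [j [k [lt_ij lt_jk pijk]]]]].
  exists (f ord0), (f (inord 1)), (f (inord 2)); split.
  - by apply: fI; rewrite inordK.
  - by apply: fI; rewrite !inordK.
  - by rewrite /pat !fP !sE !inordK //= !eqxx.
exists [ffun a : 'I_3 => nth i [:: i; j; k] a] => a b; rewrite !ffunE.
  case: a b => [[|[|[|a]]] lt_a3] [[|[|[|b]]] lt_b3] //= _.
  exact: ltn_trans lt_jk.
(* [pat] compares letters from left to right only; the opposite comparisons follow because the
   values of [pi] and the letters of [s] are distinct. *)
have rev (u v : 'I_n) c d : (u < v)%N -> c != d ->
    ((pi u < pi v) == (nth 0 s c < nth 0 s d) -> c < 3 -> d < 3 ->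
    (pi v < pi u) = (nth 0 s d < nth 0 s c))%N.
  move=> lt_uv neq_cd /eqP eq_uv c3 d3; rewrite ltnNge leq_eqVlt [RHS]ltnNge [in RHS]leq_eqVlt.
  rewrite nth_uniq ?(perm_uniq s_perm) ?iota_uniq ?(perm_size s_perm) //.
  by rewrite val_eqE (inj_eq perm_inj) -val_eqE ltn_eqF // (negPf neq_cd) eq_uv.
have lt_ik := ltn_trans lt_ij lt_jk.
rewrite sE; case/and3P: pijk => pij pik pjk.
case: a b => [[|[|[|a]]] lt_a3] [[|[|[|b]]] lt_b3] //=; rewrite ?ltnn //;
  first [exact: (eqP pij) | exact: (eqP pik) | exact: (eqP pjk) | exact: rev].
Qed.

End PermWord.

(** This separates the two tasks of each case: to show which words an explicit list contains, and to
    sum weights over that list. *)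
Lemma Fw_words (R : comNzRingType) (x q y : R) n (L : seq (seq nat)) s1 s2 s3 :
    all (fun s => perm_eq s (iota 1 3)) [:: s1; s2; s3] -> uniq L ->
    (forall w, (w \in L) = perm_eq w (iota 0 n) && tripwise (pat3 s1 s2 s3) w) ->
  Fw x q y [set oneline 2 s1; oneline 2 s2; oneline 2 s3] n =
  \sum_(w <- L) wordw x q y 0 w.
Proof.
case/and4P=> s1_perm s2_perm s3_perm _ uniqL memL.
pose av (pi : 'S_n) := avoids pi [set oneline 2 s1; oneline 2 s2; oneline 2 s3].
have avE pi : av pi = tripwise (pat3 s1 s2 s3) (permword pi).
  rewrite /av avoids3; apply/and3P/tripwiseP => [[av1 av2 av3] i j k lt_ij lt_jk | no_pat].
    rewrite size_permword => lt_kn; have lt_jn := ltn_trans lt_jk lt_kn.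
    have lt_in := ltn_trans lt_ij lt_jn.
    rewrite (nth_permword pi (Ordinal lt_in)) (nth_permword pi (Ordinal lt_jn)).
    rewrite (nth_permword pi (Ordinal lt_kn)).
    apply/negP => /or3P[] pijk; [move: av1 | move: av2 | move: av3] => /negP[];
      by apply/contains_oneline => //; exists (Ordinal lt_in), (Ordinal lt_jn), (Ordinal lt_kn).
  split; apply/negP => /contains_oneline[] // i [j [k [lt_ij lt_jk pijk]]];
    have := no_pat i j k lt_ij lt_jk; rewrite size_permword !nth_permword => /(_ (ltn_ord k));
    by rewrite /pat3 pijk ?orbT.
have pL : perm_eq L [seq permword pi | pi <- index_enum _ & av pi].
  rewrite uniq_perm ?(map_inj_uniq (@permword_inj n)) ?filter_uniq ?index_enum_uniq //.
  move=> w; rewrite memL; apply/andP/mapP => [[/permword_surj[pi ->]] tw|[pi]].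
    by exists pi; rewrite // mem_filter avE tw mem_index_enum.
  by rewrite mem_filter avE => /andP[tw _] ->; rewrite perm_eq_permword.
rewrite (perm_big _ pL) big_map big_filter; apply: eq_bigr => pi _.
rewrite /permw (wordwE _ _ _ 0%N) size_permword.
by apply: eq_bigr => i _; rewrite nth_permword.
Qed.

(* [lt false] is >: the lemmas below then describe the complementary patterns. *)
Definition lt (d : bool) (a b : nat) : bool := if d then (a < b)%N else (b < a)%N.

Lemma lt_irr d : irreflexive (lt d).
Proof. by case: d => a; rewrite /lt ltnn. Qed.

Lemma lt_trans d : transitive (lt d).
Proof. by case: d => a b c /=; lia. Qed.

Lemma ltN d a b : lt (~~ d) a b = lt d b a.
Proof. by case: d. Qed.

Lemma lt_uniq d s : pairwise (lt d) s -> uniq s.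
Proof.
rewrite uniq_pairwise; apply: sub_pairwise => a b /=.
by apply: contraTneq => ->; rewrite lt_irr.
Qed.

(** The short descriptions of bad triples used below agree with the patterns only on distinct
    letters. *)
Lemma eq_tripwise bad bad' w : uniq w ->
    (forall a b c, uniq [:: a; b; c] -> bad a b c = bad' a b c) ->
  tripwise bad w = tripwise bad' w.
Proof.
move=> + badE; elim: w => //= a w IHw /andP[a_w uniq_w]; rewrite IHw //.
congr (_ && _); elim: w a_w uniq_w {IHw} => //= b w IHw.
rewrite inE negb_or => /andP[neq_ab a_w] /andP[b_w uniq_w]; rewrite IHw //.
congr (_ && _); apply: eq_in_all => c c_w.
have neq_ac : a != c by apply: contraNneq a_w => ->.
have neq_bc : b != c by apply: contraNneq b_w => ->.
by rewrite badE //= !inE negb_or neq_ab neq_ac neq_bc.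
Qed.

Lemma tripwise_rcons bad w c :
  tripwise bad (rcons w c) = tripwise bad w && pairwise (fun a b => ~~ bad a b c) w.
Proof.
elim: w => //= a w ->; rewrite pairwise_rcons.
by rewrite -!andbA; do !bool_congr; rewrite andbC.
Qed.

Lemma tripwise_cons bad a w :
  tripwise bad (a :: w) = pairwise (fun b c => ~~ bad a b c) w && tripwise bad w.
Proof. by []. Qed.

Arguments tripwise : simpl never.

Lemma perm_cons_split d s f w : pairwise (lt d) s -> perm_eq (f :: w) s ->
  exists s1 s2, [/\ s = s1 ++ f :: s2, perm_eq w (s1 ++ s2),
                    all (lt d ^~ f) s1 & all (lt d f) s2].
Proof.
move=> s_sorted w_perm; have: f \in s by rewrite -(perm_mem w_perm) mem_head.
move=> f_s; case/splitPr: s / f_s s_sorted w_perm => s1 s2 s_sorted w_perm.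
exists s1, s2; split=> //.
- rewrite -(perm_cons f) (permPl w_perm).
  exact: permEl (perm_catCA s1 [:: f] s2).
- move: s_sorted; rewrite pairwise_cat => /and3P[/allrelP lt12 _ _].
  by apply/allP => a a_s1; rewrite lt12 ?mem_head.
by move: s_sorted; rewrite pairwise_cat /= => /and4P[_ _].
Qed.

Lemma mem_map_cons (a : nat) L w :
  (w \in [seq a :: u | u <- L]) = if w is f :: w' then (f == a) && (w' \in L) else false.
Proof.
case: w => [|f w]; first by apply/mapP => -[].
apply/mapP/andP => [[u Lu [-> ->]] | [/eqP-> Lw]]; first by rewrite eqxx.
by exists w.
Qed.

Lemma lt_sorted_eq d s t :
  pairwise (lt d) s -> pairwise (lt d) t -> perm_eq s t -> s = t.
Proof.
have tr := @lt_trans d; rewrite -!(sorted_pairwise tr) => s_sorted t_sorted /perm_mem.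
exact: (irr_sorted_eq tr (@lt_irr d)).
Qed.

Lemma mem_pairwise (r : rel nat) w b c :
  pairwise r w -> b \in w -> c \in w -> b != c -> r b c || r c b.
Proof.
move=> w_r b_w; case/splitPr: w / b_w w_r => w1 w2; rewrite pairwise_cat /=.
case/and4P=> /allrelP r12 _ /allP rb _; rewrite mem_cat inE => /or3P[c_w1|/eqP->|c_w2].
- by rewrite orbC r12 ?mem_head.
- by rewrite eqxx.
by rewrite rb.
Qed.

(** * 231, 312, 321 and their complements *)

(* 231, 312 and 321 are the patterns whose last letter is less than the first. *)
Definition bad_far d (a b c : nat) := ~~ lt d a c.

Fixpoint far_words (s : seq nat) : seq (seq nat) :=
  match s with
  | a :: ((b :: s2) as s1) =>
      [seq a :: u | u <- far_words s1] ++ [seq b :: a :: u | u <- far_words s2]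
  | _ => [:: s]
  end.

Lemma far_words_cons2 a b s : far_words [:: a, b & s] =
  [seq a :: u | u <- far_words (b :: s)] ++ [seq b :: a :: u | u <- far_words s].
Proof. by []. Qed.

Arguments far_words : simpl never.

Lemma pairwise_const (P : pred nat) b w :
  pairwise (fun _ c => P c) (b :: w) = all P w.
Proof.
rewrite /=; apply: andb_idr; elim: w => //= c w IHw /andP[_ Pw].
by rewrite Pw IHw.
Qed.

Lemma pairwise_far d a b w :
  pairwise (fun b c => ~~ bad_far d a b c) (b :: w) = all (lt d a) w.
Proof.
rewrite -(pairwise_const _ b).
by apply: (@eq_in_pairwise _ predT) => [? ? _ _|]; [apply: negbK | apply: all_predT].
Qed.

Lemma tripwise_far d f b w :
  tripwise (bad_far d) [:: f, b & w] = all (lt d f) w && tripwise (bad_far d) (b :: w).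
Proof. by rewrite tripwise_cons pairwise_far. Qed.

(** In a good word each letter precedes, in the order [lt d], everything two or more places to its
    right, so at most one lower letter follows it, and directly. The good words are therefore the
    sorted word with disjoint adjacent pairs exchanged, or tilings by blocks of one and two
    letters. *)
Lemma mem_far_words d s w : pairwise (lt d) s ->
  (w \in far_words s) = perm_eq w s && tripwise (bad_far d) w.
Proof.
have far_low a u : all (lt d a) u -> pairwise (fun b c => ~~ bad_far d a b c) u.
  by case: u => // b u /andP[_ lt_au]; rewrite pairwise_far.
(* The recursion removes one or two letters, so the claim is carried for [s] and for every [a :: s]
   at once. *)
pose P s := pairwise (lt d) s -> forall w,
  (w \in far_words s) = perm_eq w s && tripwise (bad_far d) w.
suff: P s /\ forall a, P (a :: s) by case=> Ps _ /Ps.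
have P0 : P [::].
  by move=> _ u; rewrite inE; apply/eqP/andP => [->|[/perm_small_eq->]].
elim: s {w} => [|b s [Ps Pbs]]; split=> //.
  by move=> a _ u; rewrite inE; apply/eqP/andP => [->|[/perm_small_eq->]]; rewrite ?perm_refl.
move=> a abs_sorted w; have /andP[/andP[lt_ab lt_as] /andP[lt_bs s_sorted]] := abs_sorted.
have {Pbs}Pb := Pbs b (introT andP (conj lt_bs s_sorted)).
have {Ps}Ps := Ps s_sorted.
rewrite far_words_cons2 mem_cat (map_comp (cons b) (cons a)) mem_map_cons.
have cons_low u : perm_eq u (b :: s) -> tripwise (bad_far d) (a :: u) = tripwise (bad_far d) u.
  move=> u_perm; rewrite tripwise_cons far_low // (perm_all _ u_perm) /=; exact/andP.
have cons_low2 u : perm_eq u s -> tripwise (bad_far d) (a :: u) = tripwise (bad_far d) u.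
  by move=> u_perm; rewrite tripwise_cons far_low // (perm_all _ u_perm).
case: w => [|f w]; first by rewrite mem_map_cons; apply/esym/negP => /andP[/perm_size].
rewrite mem_map_cons; have [->|neq_fa] := eqVneq f a.
  rewrite perm_cons (_ : a == b = false) ?orbF ?Pb; last first.
    by apply: contraTF lt_ab => /eqP ->; rewrite lt_irr.
  by case w_perm: (perm_eq w _) => //; rewrite cons_low.
have [->|neq_fb] := eqVneq f b.
  case: w => [|g w]; first by rewrite mem_map_cons; apply/esym/negP => /andP[/perm_size].
  rewrite mem_map_cons; have [->|neq_ga] := eqVneq g a.
    rewrite (perm_catCA [:: b] [:: a] w : perm_eq [:: b, a & w] =1 _) !perm_cons.
    rewrite orFb !andTb Ps.
    case w_perm: (perm_eq w s) => //; rewrite tripwise_far cons_low2 //.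
    by rewrite (perm_all _ w_perm) lt_bs.
  apply/esym/negP => /andP[w_perm]; rewrite tripwise_far => /andP[/allP lt_bw _].
  have: a \in [:: b, g & w] by rewrite (perm_mem w_perm) mem_head.
  rewrite !inE (eq_sym a g) (negPf neq_ga) => /orP[/eqP eq_ab | /lt_bw].
    by rewrite eq_ab lt_irr in lt_ab.
  by rewrite -ltN; case: (d) lt_ab => /=; lia.
(* A first letter other than [a] and [b] has both of them below it, but only the second place can
   hold a lower letter. *)
case: w => [|g w]; first by apply/esym/negP => /andP[/perm_size].
apply/esym/negP => /andP[w_perm]; rewrite tripwise_far => /andP[/allP lt_fw _].
have f_s : f \in s.
  have: f \in [:: a, b & s] by rewrite -(perm_mem w_perm) mem_head.
  by rewrite !inE (negPf neq_fa) (negPf neq_fb).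
have lt_af := allP lt_as f f_s; have lt_bf := allP lt_bs f f_s.
have gE c : lt d c f -> c \in [:: a, b & s] -> c = g.
  move=> lt_cf; rewrite -(perm_mem w_perm) !inE => /or3P[/eqP eq_cf|/eqP//|/lt_fw].
    by rewrite eq_cf lt_irr in lt_cf.
  by case: (d) lt_cf => /=; lia.
move: lt_ab; rewrite (gE a) ?mem_head // (gE b) ?lt_irr //.
by rewrite inE mem_head orbT.
Qed.

Lemma far_words_uniq d s : pairwise (lt d) s -> uniq (far_words s).
Proof.
pose P s := pairwise (lt d) s -> uniq (far_words s).
suff: P s /\ forall a, P (a :: s) by case=> Ps _ /Ps.
elim: s => [|b s [Ps Pbs]]; split=> //.
move=> a abs_sorted; have := lt_uniq abs_sorted; rewrite /= inE negb_or => /andP[/andP[neq_ab _] _].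
have /and3P[_ lt_bs s_sorted] := abs_sorted.
rewrite far_words_cons2 cat_uniq !map_inj_uniq ?Ps ?Pbs /= ?lt_bs ?andbT //; last 2 first.
- by move=> u v [].
- by move=> u v [].
by apply/hasPn => _ /mapP[u _ ->]; rewrite mem_map_cons eq_sym (negPf neq_ab).
Qed.

(** * Patterns with a recursion on the least letter *)

(* For (d, g) = (true, true), (true, false), (false, false), (false, true) these
   are {213, 231, 321}, {213, 231, 312}, {123, 213, 231} and {132, 213, 231}. *)
Definition bad_peak d g (a b c : nat) :=
  if lt d a b && lt d a c then false
  else if lt d b a && lt d c a then ~~ lt g b c else true.

(** In both cases the last letter of [s] moves to the front; [k] tells whether the others keep or
    reverse their order. *)
Definition swing (k : bool) (s : seq nat) := if k then rotr 1 s else rev s.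

(** The test [nilp s1] prevents a double listing: a single letter is both the least and the
    greatest. *)
Fixpoint peak_words (k : bool) (s : seq nat) : seq (seq nat) :=
  if s is a :: s1 then
    [seq a :: u | u <- peak_words k s1] ++ (if nilp s1 then [::] else [:: swing k s])
  else [:: [::]].

Lemma peak_words_cons k a s : peak_words k (a :: s) =
  [seq a :: u | u <- peak_words k s] ++ (if nilp s then [::] else [:: swing k (a :: s)]).
Proof. by []. Qed.

Arguments peak_words : simpl never.

Lemma swing_rcons k s f : swing k (rcons s f) = f :: (if k then s else rev s).
Proof. by case: k; rewrite /swing ?rotr1_rcons ?rev_rcons. Qed.

Lemma pairwise_rev (r : rel nat) s : pairwise r (rev s) = pairwise (fun a b => r b a) s.
Proof. by elim: s => //= a s <-; rewrite rev_cons pairwise_rcons all_rev. Qed.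

Section PeakWords.
Variables d g : bool.

Lemma pairwise_peak_low a u : all (lt d a) u ->
  pairwise (fun b c => ~~ bad_peak d g a b c) u.
Proof.
move=> lt_au; rewrite (@eq_in_pairwise _ (lt d a) _ (fun _ _ => true)) //.
  by elim: u {lt_au} => //= b u ->; rewrite all_predT.
move=> b c lt_ab lt_ac; rewrite /bad_peak (lt_ab : lt d a b) //.
by rewrite (lt_ac : lt d a c).
Qed.

Lemma pairwise_peak_high a u : all (lt d ^~ a) u ->
  pairwise (fun b c => ~~ bad_peak d g a b c) u = pairwise (lt g) u.
Proof.
move=> lt_ua; apply: (eq_in_pairwise _ lt_ua) => b c lt_ba lt_ca.
rewrite /bad_peak (lt_ba : lt d b a) (lt_ca : lt d c a).
case: ifP => [/andP[lt_ab _]|_]; last exact: negbK.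
by have := lt_trans lt_ab lt_ba; rewrite lt_irr.
Qed.

Lemma pairwise_turn s :
  pairwise (lt d) s -> pairwise (lt g) (if g == d then s else rev s).
Proof.
case: eqP => [-> //|/eqP neq_gd]; rewrite pairwise_rev.
by case: (d) (g) neq_gd => [] [].
Qed.

Lemma tripwise_peak w : pairwise (lt g) w -> tripwise (bad_peak d g) w.
Proof.
elim: w => // a w IHw /= /andP[lt_aw w_sorted]; rewrite tripwise_cons IHw // andbT.
have [/eqP eq_dg | neq_dg] := boolP (d == g).
  by apply: pairwise_peak_low; rewrite eq_dg.
rewrite pairwise_peak_high //; apply: sub_all lt_aw => b.
by rewrite (_ : g = ~~ d) ?ltN //; case: (d) (g) neq_dg => [] [].
Qed.

(** The first letter imposes nothing if it is least; if it is greatest, it forces the rest to be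
    sorted by [lt g], which leaves one word; strictly between two later letters it starts a bad
    triple. The rest keeps the order of [s] exactly when [g == d]. *)
Lemma mem_peak_words s w : pairwise (lt d) s ->
  (w \in peak_words (g == d) s) = perm_eq w s && tripwise (bad_peak d g) w.
Proof.
elim: s w => [|a s IHs] w.
  by move=> _; rewrite inE; apply/eqP/andP => [->|[/perm_small_eq->]].
move=> as_sorted; have /andP[lt_as s_sorted] := as_sorted.
rewrite peak_words_cons mem_cat mem_map_cons; case: w => [|f w].
  rewrite orFb; apply/idP/andP => [|[/perm_size //]].
  case: nilP => // _; rewrite inE => /eqP /(congr1 size).
  by rewrite /swing; case: eqP => _; rewrite ?size_rotr ?size_rev.
have [->|neq_fa] := eqVneq f a.
  rewrite perm_cons andTb IHs //; case: nilP => [->|/eqP s_neq0]; rewrite ?orbF.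
    by apply: andb_id2l => w_perm; rewrite tripwise_cons pairwise_peak_low // (perm_all _ w_perm).
  case/lastP: s s_neq0 as_sorted lt_as {IHs s_sorted} => // s l _ as_sorted lt_as.
  rewrite inE -rcons_cons swing_rcons eqseq_cons (_ : a == l = false) ?orbF.
    by apply: andb_id2l => w_perm; rewrite tripwise_cons pairwise_peak_low // (perm_all _ w_perm).
  by apply: contraTF lt_as => /eqP->; rewrite all_rcons lt_irr.
rewrite orFb; apply/idP/andP => [|[w_perm]].
  case: nilP => // /eqP; case/lastP: s as_sorted {IHs s_sorted lt_as} => // s l.
  rewrite -rcons_cons pairwise_rcons => /andP[lt_l as_sorted] _; rewrite inE swing_rcons.
  set r := if _ then _ else _; case/eqP=> -> ->.
  have r_perm : perm_eq r (a :: s) by rewrite /r; case: ifP; rewrite ?perm_rev.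
  rewrite perm_sym perm_rcons perm_cons perm_sym r_perm; split=> //.
  have r_sorted : pairwise (lt g) r by apply: pairwise_turn.
  rewrite tripwise_cons pairwise_peak_high ?(perm_all _ r_perm) //.
  by rewrite r_sorted tripwise_peak.
have [s1 [s2 [eq_as w_perm' lt_s1f lt_fs2]]] := perm_cons_split as_sorted w_perm.
rewrite tripwise_cons => /andP[w_good _].
case: s1 eq_as w_perm' lt_s1f => [[eq_af]|a' s1 [<- eq_s]]; first by rewrite eq_af eqxx in neq_fa.
(* With [a] below and [c] above it, [f] forms a bad triple with these two in whichever order they
   occur. *)
case: s2 lt_fs2 eq_s => [_ eq_s | c s2 /andP[lt_fc _] _ w_perm' /andP[lt_af _]]; last first.
  have a_w : a \in w by rewrite (perm_mem w_perm') mem_head.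
  have c_w : c \in w by rewrite (perm_mem w_perm') mem_cat mem_head orbT.
  have neq_ac : a != c by apply: contraTneq lt_fc => <-; rewrite -ltN; case: (d) lt_af => /=; lia.
  have := mem_pairwise w_good a_w c_w neq_ac; rewrite /bad_peak.
  have -> : lt d f a = false by case: (d) lt_af => /=; lia.
  have -> : lt d c f = false by case: (d) lt_fc => /=; lia.
  by rewrite !andbF.
rewrite cats0 => w_perm' lt_asf; rewrite eq_s cats1 -rcons_cons.
rewrite (_ : nilp _ = false) ?inE ?swing_rcons ?eqseq_cons ?eqxx; last by case: (s1).
apply/eqP/(@lt_sorted_eq g).
- by rewrite -(@pairwise_peak_high f) ?(perm_all _ w_perm').
- apply: pairwise_turn; move: as_sorted.
  by rewrite eq_s -cat_cons pairwise_cat => /and3P[].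
by rewrite (permPl w_perm'); case: ifP; rewrite // perm_sym perm_rev.
Qed.

Lemma peak_words_uniq k s : pairwise (lt d) s -> uniq (peak_words k s).
Proof.
elim: s => // a s IHs as_sorted; have /andP[lt_as s_sorted] := as_sorted.
rewrite peak_words_cons cat_uniq map_inj_uniq ?IHs // => [|u v []//].
case: nilP => //= /eqP; case/lastP: s as_sorted lt_as {IHs s_sorted} => // s l _ + _.
rewrite all_rcons => /andP[lt_al _]; rewrite orbF andbT -rcons_cons swing_rcons mem_map_cons.
by rewrite (_ : l == a = false) //; apply: contraTF lt_al => /eqP->; rewrite lt_irr.
Qed.

End PeakWords.

(** * Rotations *)

Definition cyc d (a b c : nat) :=
  [|| lt d a b && lt d b c, lt d b c && lt d c a | lt d c a && lt d a b].

Definition bad_cyc d (a b c : nat) := ~~ cyc d a b c.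

(** The bound [(size s).-1.+1] gives one rotation to the empty list and [size s] rotations to any
    other. *)
Definition rot_words (s : seq nat) : seq (seq nat) :=
  [seq rot k s | k <- iota 0 (size s).-1.+1].

Section RotWords.
Variable d : bool.

(** With [a] fixed, [cyc d a] is the strict order of the other letters read around the circle from
    [a]. *)
Lemma cyc_trans a : transitive (cyc d a).
Proof. by move=> c b e; rewrite /cyc; case: d => /=; lia. Qed.

Lemma cyc_irr a : irreflexive (cyc d a).
Proof. by move=> b; rewrite /cyc; case: d => /=; lia. Qed.

Lemma tripwise_cyc_cons a w :
  tripwise (bad_cyc d) (a :: w) = pairwise (cyc d a) w && tripwise (bad_cyc d) w.
Proof.
rewrite tripwise_cons; congr (_ && _).
by apply: (@eq_in_pairwise _ predT) => [b c _ _|]; [apply: negbK | apply: all_predT].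
Qed.

Lemma tripwise_cyc_rot k w : tripwise (bad_cyc d) w -> tripwise (bad_cyc d) (rot k w).
Proof.
have rot1 u : tripwise (bad_cyc d) u -> tripwise (bad_cyc d) (rot 1 u).
  case: u => // a u; rewrite rot1_cons tripwise_rcons tripwise_cyc_cons andbC.
  case/andP=> -> /=; apply: sub_pairwise => b c; rewrite /bad_cyc negbK /cyc.
  by case: d => /=; lia.
have [lt_kw|le_wk] := ltnP k (size w); last by rewrite rot_oversize.
elim: k lt_kw => [|k IHk] lt_kw w_good; first by rewrite rot0.
by rewrite rotS ?rot1 ?IHk // ltnW.
Qed.

Lemma tripwise_cyc_sorted w : pairwise (lt d) w -> tripwise (bad_cyc d) w.
Proof.
elim: w => // a w IHw /andP[lt_aw w_sorted]; rewrite tripwise_cyc_cons IHw // andbT.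
elim: w lt_aw w_sorted {IHw} => //= b w IHw /andP[lt_ab lt_aw] /andP[lt_bw w_sorted].
by rewrite IHw // andbT; apply: sub_all lt_bw => c lt_bc; rewrite /cyc lt_ab lt_bc.
Qed.

Lemma mem_rot_words s w : pairwise (lt d) s ->
  (w \in rot_words s) = perm_eq w s && tripwise (bad_cyc d) w.
Proof.
move=> s_sorted; apply/mapP/andP => [[k _ ->]|[w_perm w_good]].
  by rewrite perm_rot perm_refl tripwise_cyc_rot ?tripwise_cyc_sorted.
case: w w_perm w_good => [|f w] w_perm.
  rewrite perm_sym in w_perm => _.
  by exists 0%N; rewrite ?mem_iota ?rot0 // (perm_small_eq _ w_perm).
rewrite tripwise_cyc_cons => /andP[w_sorted _].
have [s1 [s2 [eq_s w_perm' _ _]]] := perm_cons_split s_sorted w_perm.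
(* The rotation of [s] that starts with [f] is also good. After [f], both words list the same
   letters sorted by [cyc d f], hence they coincide. *)
exists (size s1); first by rewrite mem_iota eq_s size_cat /=; lia.
have := tripwise_cyc_rot (size s1) (tripwise_cyc_sorted s_sorted).
rewrite eq_s rot_size_cat /= tripwise_cyc_cons => /andP[s_rot _]; congr (_ :: _).
have tr := @cyc_trans f; apply: (irr_sorted_eq tr (@cyc_irr f)).
- by rewrite (sorted_pairwise tr).
- by rewrite (sorted_pairwise tr).
by apply/perm_mem; rewrite (permPl w_perm') perm_catC.
Qed.

Lemma rot_words_uniq s : pairwise (lt d) s -> uniq (rot_words s).
Proof.
move/lt_uniq => s_uniq; rewrite map_inj_in_uniq ?iota_uniq // => j k.
rewrite !mem_iota !add0n /=; case: s s_uniq => [|a s] s_uniq /= lt_js lt_ks; first by lia.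
move/(congr1 (head 0%N)); rewrite /rot (drop_nth 0%N) // [X in _ = _ _ (X ++ _)](drop_nth 0%N) //=.
by move/eqP; rewrite (nth_uniq 0%N _ _ s_uniq) // => /eqP.
Qed.

End RotWords.

Lemma Fw_enum (R : comNzRingType) (x q y : R) n bad (L : seq nat -> seq (seq nat)) s s1 s2 s3 :
    all (fun s => perm_eq s (iota 1 3)) [:: s1; s2; s3] ->
    (forall a b c, uniq [:: a; b; c] -> pat3 s1 s2 s3 a b c = bad a b c) ->
    perm_eq s (iota 0 n) -> uniq (L s) ->
    (forall w, (w \in L s) = perm_eq w s && tripwise bad w) ->
  Fw x q y [set oneline 2 s1; oneline 2 s2; oneline 2 s3] n =
  \sum_(w <- L s) wordw x q y 0 w.
Proof.
move=> s_perm badE sn_perm uniqL memL; apply: Fw_words => // w.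
rewrite memL (permPr sn_perm); apply: andb_id2l => w_perm; apply/esym/eq_tripwise => //.
by rewrite (perm_uniq w_perm) iota_uniq.
Qed.

Fixpoint down b m := if m is m'.+1 then (b + m')%N :: down b m' else [::].

Lemma down_rev b m : down b m = rev (iota b m).
Proof. by elim: m => // m IHm; rewrite -addn1 iotaD rev_cat -IHm addn1. Qed.

Lemma down_sorted b m : pairwise (lt false) (down b m).
Proof.
rewrite down_rev pairwise_rev -(@sorted_pairwise _ _ ltn_trans); exact: iota_ltn_sorted.
Qed.

Lemma iota_sorted b m : pairwise (lt true) (iota b m).
Proof. rewrite -(@sorted_pairwise _ _ ltn_trans); exact: iota_ltn_sorted. Qed.

(** * Words avoiding three patterns *)

Section Enumerations.
Variables (R : comNzRingType) (x q y : R) (n : nat).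
Local Notation Fw := (Fw x q y).
Local Notation wt := (wordw x q y 0).

Let down_perm : perm_eq (down 0 n) (iota 0 n).
Proof. by rewrite down_rev perm_rev. Qed.

Ltac compare_letters :=
  move=> a b c; rewrite /= !inE /pat3 /pat /bad_far /bad_peak /bad_cyc /cyc /=; do 2?case: ifP; lia.

Lemma Fw_123_132_213 : Fw [set p123; p132; p213] n = \sum_(w <- far_words (down 0 n)) wt w.
Proof.
apply: (@Fw_enum _ _ _ _ _ (bad_far false)) => //; first compare_letters.
  exact/far_words_uniq/down_sorted.
by move=> w; apply/mem_far_words/down_sorted.
Qed.

Lemma Fw_231_312_321 : Fw [set p231; p312; p321] n = \sum_(w <- far_words (iota 0 n)) wt w.
Proof.
apply: (@Fw_enum _ _ _ _ _ (bad_far true)) => //; first compare_letters.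
  exact/far_words_uniq/iota_sorted.
by move=> w; apply/mem_far_words/iota_sorted.
Qed.

Lemma Fw_123_213_231 : Fw [set p123; p213; p231] n = \sum_(w <- peak_words true (down 0 n)) wt w.
Proof.
apply: (@Fw_enum _ _ _ _ _ (bad_peak false false)) => //; first compare_letters.
  exact/peak_words_uniq/down_sorted.
by move=> w; apply: (@mem_peak_words false false); apply: down_sorted.
Qed.

Lemma Fw_213_231_321 : Fw [set p213; p231; p321] n = \sum_(w <- peak_words true (iota 0 n)) wt w.
Proof.
apply: (@Fw_enum _ _ _ _ _ (bad_peak true true)) => //; first compare_letters.
  exact/peak_words_uniq/iota_sorted.
by move=> w; apply: (@mem_peak_words true true); apply: iota_sorted.
Qed.

Lemma Fw_132_213_231 : Fw [set p132; p213; p231] n = \sum_(w <- peak_words false (down 0 n)) wt w.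
Proof.
apply: (@Fw_enum _ _ _ _ _ (bad_peak false true)) => //; first compare_letters.
  exact/peak_words_uniq/down_sorted.
by move=> w; apply: (@mem_peak_words false true); apply: down_sorted.
Qed.

Lemma Fw_213_231_312 : Fw [set p213; p231; p312] n = \sum_(w <- peak_words false (iota 0 n)) wt w.
Proof.
apply: (@Fw_enum _ _ _ _ _ (bad_peak true false)) => //; first compare_letters.
  exact/peak_words_uniq/iota_sorted.
by move=> w; apply: (@mem_peak_words true false); apply: iota_sorted.
Qed.

Lemma Fw_123_231_312 : Fw [set p123; p231; p312] n = \sum_(w <- rot_words (down 0 n)) wt w.
Proof.
apply: (@Fw_enum _ _ _ _ _ (bad_cyc false)) => //; first compare_letters.
  exact/rot_words_uniq/down_sorted.
by move=> w; apply/mem_rot_words/down_sorted.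
Qed.

Lemma Fw_132_213_321 : Fw [set p132; p213; p321] n = \sum_(w <- rot_words (iota 0 n)) wt w.
Proof.
apply: (@Fw_enum _ _ _ _ _ (bad_cyc true)) => //; first compare_letters.
  exact/rot_words_uniq/iota_sorted.
by move=> w; apply/mem_rot_words/iota_sorted.
Qed.

End Enumerations.

(** * Direct enumeration and monotone triples *)

Lemma Fw_permutations (R : comNzRingType) (x q y : R) n s1 s2 s3 :
    all (fun s => perm_eq s (iota 1 3)) [:: s1; s2; s3] ->
  Fw x q y [set oneline 2 s1; oneline 2 s2; oneline 2 s3] n =
  \sum_(w <- [seq w <- permutations (iota 0 n) | tripwise (pat3 s1 s2 s3) w]) wordw x q y 0 w.
Proof.
move=> s_perm; apply: Fw_words => // [|w]; first by rewrite filter_uniq ?permutations_uniq.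
by rewrite mem_filter mem_permutations andbC.
Qed.

(** The bound is that of Erdos and Szekeres, 5 = 2 * 2 + 1. The ten triples among the first five
    letters suffice, and [lia] decides their comparisons. *)
Lemma monotone_triple (bad : nat -> nat -> nat -> bool) w :
    (forall a b c, (a < b < c)%N || (c < b < a)%N -> bad a b c) ->
  uniq w -> (4 < size w)%N -> ~~ tripwise bad w.
Proof.
move=> badM; case: w => [|a [|b [|c [|e [|f w]]]]] // w_uniq _.
apply/tripwiseP => no_bad.
have nbad i j k (ltij : (i < j < k)%N) : (k < 5)%N ->
    let u := nth 0 [:: a, b, c, e, f & w] in
    ~~ ((u i < u j < u k)%N || (u k < u j < u i)%N).
  case/andP: ltij => lt_ij lt_jk lt_k5;
  apply: contra (no_bad i j k lt_ij lt_jk _); first exact: badM.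
  by apply: leq_trans lt_k5 _.
move: w_uniq (nbad 0 1 2 isT isT) (nbad 0 1 3 isT isT) (nbad 0 1 4 isT isT).
move: (nbad 0 2 3 isT isT) (nbad 0 2 4 isT isT) (nbad 0 3 4 isT isT).
move: (nbad 1 2 3 isT isT) (nbad 1 2 4 isT isT) (nbad 1 3 4 isT isT) (nbad 2 3 4 isT isT).
rewrite /= !inE !negb_or; clear; lia.
Qed.

(** [fib n.+1] counts the tilings of n places by blocks of length one and two; [fib 0 = 0] removes
    the terms below in which no block can straddle the middle. *)
Fixpoint fib (n : nat) : nat :=
  if n is n'.+1 then if n' is n''.+1 then fib n' + fib n'' else 1 else 0.

Lemma fibSS n : fib n.+2 = (fib n.+1 + fib n)%N. Proof. by []. Qed.
Arguments fib : simpl never.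

(** * Weights of increasing and decreasing words *)

Section WordWeights.
Variables (R : comNzRingType) (x q y : R).
Local Notation lw := (letw x q y).
Local Notation wt := (wordw x q y).
Implicit Types p n m k : nat.

Definition sumw p (L : seq (seq nat)) : R := \sum_(w <- L) wt p w.

Lemma sumw_cat p L1 L2 : sumw p (L1 ++ L2) = sumw p L1 + sumw p L2.
Proof. exact: big_cat. Qed.

Lemma sumw1 p w : sumw p [:: w] = wt p w.
Proof. exact: big_seq1. Qed.

Lemma sumw_cons p a L : sumw p [seq a :: u | u <- L] = lw p a * sumw p.+1 L.
Proof. by rewrite /sumw big_map mulr_sumr. Qed.

Lemma wordw_cons p a w : wt p (a :: w) = lw p a * wt p.+1 w.
Proof. by []. Qed.

Lemma wordw_anti p w : all (ltn^~ p) w -> wt p w = y ^+ size w.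
Proof.
elim: w p => //= a w IHw p /andP[lt_ap lt_wp]; rewrite letw_anti // IHw ?exprS //.
by apply: sub_all lt_wp => b /= /leqW.
Qed.

Lemma wordw_iota k p m : wt p (iota (k + p) m) = (if k is 0%N then x else q) ^+ m.
Proof.
elim: m p => // m IHm p; rewrite /= -addnS IHm exprS; congr (_ * _).
by case: k {IHm} => [|k]; rewrite ?letwE ?letw_exc // addSn ltnS leq_addl.
Qed.

Lemma wordw_iota_anti k p m : wt (k.+1 + p) (iota p m) = y ^+ m.
Proof.
elim: m p => // m IHm p; rewrite /= -addnS IHm exprS letw_anti //.
by rewrite addSn ltnS leq_addl.
Qed.

Lemma down_cat b j m : down b (j + m) = down (b + j) m ++ down b j.
Proof. by rewrite !down_rev iotaD rev_cat. Qed.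

Lemma down_rcons b m : down b m.+1 = rcons (down b.+1 m) b.
Proof. by rewrite !down_rev -rev_cons. Qed.

Lemma size_down b m : size (down b m) = m.
Proof. by rewrite down_rev size_rev size_iota. Qed.

(** The weight of m consecutive letters in decreasing order on their own positions: opposite ends
    pair up to [q * y], and a middle letter is fixed. *)
Definition dec m : R := (if odd m then x else 1) * (q * y) ^+ m./2.

Lemma dec_double k : dec k.*2 = (q * y) ^+ k.
Proof. by rewrite /dec odd_double doubleK mul1r. Qed.

Lemma dec_doubleS k : dec k.*2.+1 = x * (q * y) ^+ k.
Proof. by rewrite /dec /= odd_double uphalf_double. Qed.

Lemma wordw_down p m : wt p (down p m) = dec m.
Proof.
have [k] := ubnP m; elim: k p m => // k IHk p [|[|m]] lt_mk.
- by rewrite /dec /= mulr1.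
- by rewrite /dec /= addn0 letwE.
change (down p m.+2) with ((p + m.+1)%N :: down p m.+1); rewrite down_rcons /=.
rewrite -cats1 wordw_cat size_down IHk; last by lia.
rewrite /= letw_exc ?letw_anti /dec /= ?exprS ?negbK; [by ring | lia | lia].
Qed.

Lemma wordw_down_anti p b m : (b + m <= p)%N -> wt p (down b m) = y ^+ m.
Proof.
move=> le_bmp; rewrite wordw_anti ?size_down //; apply/allP => a.
by rewrite down_rev mem_rev mem_iota /=; lia.
Qed.

(** The upper m letters fill exactly their own positions, and the lower j come after them, below
    their positions. *)
Lemma wordw_down_shift b j m : wt (b + j) (down b (j + m)) = dec m * y ^+ j.
Proof.
by rewrite down_cat wordw_cat wordw_down wordw_down_anti // size_down leq_addr.
Qed.

(** * Weighted sums *)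

Lemma far_iota0 p : sumw p (far_words (iota p 0)) = 1.
Proof. exact: sumw1. Qed.

Lemma far_iota1 p : sumw p (far_words (iota p 1)) = x.
Proof. by rewrite sumw1 /= letwE mulr1. Qed.

Lemma far_iotaSS p n : sumw p (far_words (iota p n.+2)) =
  x * sumw p.+1 (far_words (iota p.+1 n.+1)) + q * y * sumw p.+2 (far_words (iota p.+2 n)).
Proof.
rewrite far_words_cons2 sumw_cat (map_comp (cons _) (cons _)) !sumw_cons letwE.
by rewrite letw_exc // letw_anti // mulrA.
Qed.

Lemma far_iota_shift p n : sumw p (far_words (iota p n)) = sumw 0 (far_words (iota 0 n)).
Proof.
suff: forall p, sumw p (far_words (iota p n)) = sumw 0 (far_words (iota 0 n)) /\
    sumw p (far_words (iota p n.+1)) = sumw 0 (far_words (iota 0 n.+1)) by case/(_ p).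
elim: n {p} => [|n IHn] p; first by rewrite !far_iota0 !far_iota1.
split; first by case: (IHn p).
rewrite !far_iotaSS; case: (IHn p.+2) (IHn 2%N) => -> _ [-> _].
by case: (IHn p.+1) (IHn 1%N) => _ -> [_ ->].
Qed.

Local Notation far p n := (sumw p (far_words (down 0 n))).

Lemma far_downSS p n :
  far p n.+2 = lw p n.+1 * far p.+1 n.+1 + lw p n * lw p.+1 n.+1 * far p.+2 n.
Proof.
by rewrite far_words_cons2 sumw_cat (map_comp (cons _) (cons _)) !sumw_cons mulrA.
Qed.

Lemma far_down_anti p n : (n <= p)%N -> far p n = y ^+ n * (fib n.+1)%:R.
Proof.
have [k] := ubnP n; elim: k n p => // k IHk [|[|n]] p lt_nk le_np.
- by rewrite [LHS]sumw1 mul1r.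
- by rewrite [LHS]sumw1 /= letw_anti.
rewrite far_downSS !letw_anti ?IHk ?fibSS ?natrD ?exprS //; try lia.
by ring.
Qed.

(** Cut the tiling after k letters. If a block ends there, k letters exceed their positions and p +
    k lie below them; otherwise a two-letter block straddles the cut and its exchanged letters are
    both fixed, whence [x ^+ 2]. *)
Lemma far_down_even p k : far p (p + k.*2) =
  q ^+ k * (fib k.+1)%:R * y ^+ (p + k) * (fib (p + k).+1)%:R +
  x ^+ 2 * q ^+ k.-1 * (fib k)%:R * y ^+ (p + k).-1 * (fib (p + k))%:R.
Proof.
have [n] := ubnP k; elim: n k p => // n IHn [|[|k]] p lt_kn.
- by rewrite !addn0 far_down_anti // /fib /=; ring.
- have le_p2 : (p <= p.+2)%N by lia.
  rewrite addn2 far_downSS letw_exc // !letwE !far_down_anti // !addn1 /=.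
  by rewrite !(exprS, expr0) /fib /=; ring.
have -> : (p + k.+2.*2 = (p.+2 + k.*2).+2)%N by lia.
rewrite far_downSS !letw_exc; try lia.
have -> : ((p.+2 + k.*2).+1 = p.+1 + k.+1.*2)%N by lia.
rewrite !IHn; try lia.
have -> : (p.+1 + k.+1 = (p + k).+2)%N by lia.
have -> : (p.+2 + k = (p + k).+2)%N by lia.
have -> : (p + k.+2 = (p + k).+2)%N by lia.
rewrite !fibSS !natrD; case: k {IHn lt_kn} => [|k] /=; rewrite !(exprS, expr0).
  by rewrite /fib /=; ring.
by ring.
Qed.

(** The three terms correspond to the middle letter: it is a block by itself and fixed, or is
    exchanged with the next letter and both fall below their positions, or with the preceding one
    and both exceed them. *)
Lemma far_down_odd p k : far p (p + k.*2.+1) =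
  q ^+ k * (fib k.+1)%:R * (x * y ^+ (p + k) * (fib (p + k).+1)%:R
                            + y ^+ (p + k).+1 * (fib (p + k))%:R)
  + q ^+ k.+1 * (fib k)%:R * y ^+ (p + k) * (fib (p + k).+1)%:R.
Proof.
have [n] := ubnP k; elim: n k p => // n IHn [|[|k]] p lt_kn.
- rewrite !addn0 addn1; case: p => [|p].
    by rewrite [LHS]sumw1 /= letwE /fib /=; ring.
  have le_p3 : (p <= p.+3)%N by lia.
  rewrite far_downSS letwE !letw_anti // !far_down_anti // !fibSS !natrD.
  by rewrite !(exprS, expr0) /fib /=; ring.
- have -> : (p + 1.*2.+1 = p.+1.+2)%N by lia.
  rewrite far_downSS !letw_exc; try lia.
  have -> : (p.+2 = p.+1 + 0.*2.+1)%N by lia.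
  rewrite IHn // far_down_anti; try lia.
  rewrite !addn0 !addn1 !fibSS !natrD.
  by rewrite !(exprS, expr0) /fib /=; ring.
have -> : (p + k.+2.*2.+1 = (p.+2 + k.*2.+1).+2)%N by lia.
rewrite far_downSS !letw_exc; try lia.
have -> : ((p.+2 + k.*2.+1).+1 = p.+1 + k.+1.*2.+1)%N by lia.
rewrite !IHn; try lia.
have -> : (p.+1 + k.+1 = (p + k).+2)%N by lia.
have -> : (p.+2 + k = (p + k).+2)%N by lia.
have -> : (p + k.+2 = (p + k).+2)%N by lia.
by rewrite !fibSS !natrD !(exprS, expr0); ring.
Qed.

Lemma peak_downSS p n (c : bool) : sumw p (peak_words c (down 0 n.+2)) =
  lw p n.+1 * sumw p.+1 (peak_words c (down 0 n.+1)) +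
  wt p (if c then 0%N :: down 1 n.+1 else iota 0 n.+2).
Proof.
rewrite peak_words_cons sumw_cat sumw_cons [X in _ + X]sumw1; congr (_ + wt p _).
rewrite -/(down 0 n.+2); case: c; first by rewrite down_rcons swing_rcons.
by rewrite /swing down_rev revK.
Qed.

Local Notation peak k p n := (sumw p (peak_words k (down 0 n))).

Lemma peak_down_anti (c : bool) p n : (n.+1 <= p)%N -> peak c p n.+1 = n.+1%:R * y ^+ n.+1.
Proof.
elim: n p => [|n IHn] p le_np; first by rewrite [LHS]sumw1 /= letw_anti // mulr1 mul1r expr1.
rewrite peak_downSS letw_anti // IHn; last by lia.
rewrite wordw_anti; first by case: (c) => /=; rewrite ?size_down ?size_iota !exprS -natr1; ring.
case: (c); apply/allP => a; last by rewrite mem_iota /=; lia.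
by rewrite down_rev in_cons mem_rev mem_iota /=; lia.
Qed.

(** A word descends for some j letters and then puts 0 before the rest. If j < k, exactly one letter
    is fixed; from j = k on, only letters of weight y remain after the first k. The start is
    positive because 0 is fixed at position 0. *)
Lemma peak_true_even p k : peak true p.+1 (p.+1 + k.*2) =
  q ^+ k * (p.+1 + k)%:R * y ^+ (p.+1 + k) + k%:R * q ^+ k.-1 * x * y ^+ (p.+1 + k).
Proof.
elim: k p => [|k IHk] p; first by rewrite !addn0 peak_down_anti //; ring.
have -> : (p.+1 + k.+1.*2 = (p + k.*2).+1.+2)%N by lia.
rewrite peak_downSS letw_exc; last by lia.
have -> : ((p + k.*2).+2 = p.+2 + k.*2)%N by lia.
have down_wt : wt p.+2 (down 1 (p.+2 + k.*2)) = dec k.*2.+1 * y ^+ p.+1.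
  by rewrite -(wordw_down_shift 1 p.+1); congr (wt _ (down 1 _)); lia.
rewrite IHk wordw_cons down_wt letw_anti // dec_doubleS.
have -> : (p.+1 + k.+1 = p.+2 + k)%N by lia.
case: k {IHk down_wt} => [|k]; rewrite ?addn0 /= !(exprMn, exprS, exprD, expr0); ring.
Qed.

Lemma peak_true_odd p k : peak true p.+1 (p.+1 + k.*2.+1) =
  (p.+1 + k)%:R * q ^+ k * x * y ^+ (p.+1 + k) + k.+1%:R * q ^+ k * y ^+ (p.+1 + k).+1.
Proof.
elim: k p => [|k IHk] p.
  have -> : (p.+1 + 0.*2.+1 = p.+2)%N by lia.
  rewrite peak_downSS letwE peak_down_anti // wordw_cons letw_anti // wordw_down_anti //.
  by rewrite !addn0 !exprS; ring.
have -> : (p.+1 + k.+1.*2.+1 = (p + k.*2.+1).+1.+2)%N by lia.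
rewrite peak_downSS letw_exc; last by lia.
have -> : ((p + k.*2.+1).+2 = p.+2 + k.*2.+1)%N by lia.
have down_wt : wt p.+2 (down 1 (p.+2 + k.*2.+1)) = dec k.+1.*2 * y ^+ p.+1.
  by rewrite -(wordw_down_shift 1 p.+1); congr (wt _ (down 1 _)); lia.
rewrite IHk wordw_cons down_wt letw_anti // dec_double.
have -> : (p.+1 + k.+1 = p.+2 + k)%N by lia.
rewrite !(exprMn, exprS, exprD, expr0); ring.
Qed.

Lemma peak_true0_even k : peak true 0 k.+1.*2 =
  k.+1%:R * q ^+ k.+1 * y ^+ k.+1 + k%:R * q ^+ k * x * y ^+ k.+1 + x ^+ 2 * (q * y) ^+ k.
Proof.
rewrite doubleS peak_downSS letw_exc // wordw_cons letwE wordw_down dec_doubleS.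
rewrite (peak_true_even 0 k) add1n; case: k => [|k]; rewrite /= !exprS; ring.
Qed.

Lemma peak_true0_odd k : peak true 0 k.+1.*2.+1 =
  k.+1%:R * q ^+ k.+1 * x * y ^+ k.+1 + k.+1%:R * q ^+ k.+1 * y ^+ k.+2
  + x * (q * y) ^+ k.+1.
Proof.
rewrite doubleS peak_downSS letw_exc // wordw_cons letwE wordw_down -doubleS dec_double.
rewrite (peak_true_odd 0 k : peak true 1 k.*2.+2 = _) add1n !exprMn !exprS; ring.
Qed.

(** The quotient of q^n - y^n by q - y, written without division. *)
Fixpoint geo n : R := if n is n'.+1 then q ^+ n' + y * geo n' else 0.

Lemma geoS n : geo n.+1 = q ^+ n + y * geo n. Proof. by []. Qed.

Lemma geoSr n : geo n.+1 = y ^+ n + q * geo n.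
Proof.
elim: n => [|n IHn]; first by rewrite /=; ring.
by rewrite geoS {1}IHn [in RHS]geoS !exprS; ring.
Qed.

(** If the word turns increasing after j < k descents, all later letters lie below their positions
    and its weight is q^j y^(p+1+2k-j); these weights add up to the term with [geo k]. *)
Lemma peak_false_even p k : peak false p.+1 (p.+1 + k.*2) =
  q ^+ k * (p.+1 + k)%:R * y ^+ (p.+1 + k) + y ^+ (p.+1 + k).+1 * geo k.
Proof.
elim: k p => [|k IHk] p; first by rewrite !addn0 peak_down_anti //=; ring.
have -> : (p.+1 + k.+1.*2 = (p + k.*2).+1.+2)%N by lia.
rewrite peak_downSS letw_exc; last by lia.
have -> : ((p + k.*2).+2 = p.+2 + k.*2)%N by lia.
rewrite IHk -[X in wt X](addn0 p.+1) wordw_iota_anti geoSr.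
have -> : (p.+1 + k.+1 = p.+2 + k)%N by lia.
by rewrite -addnn !(exprS, exprD); ring.
Qed.

Lemma peak_false_odd p k : peak false p.+1 (p.+1 + k.*2.+1) =
  q ^+ k * ((p.+1 + k)%:R * x * y ^+ (p.+1 + k) + y ^+ (p.+1 + k).+1)
  + y ^+ (p.+1 + k).+2 * geo k.
Proof.
elim: k p => [|k IHk] p.
  have -> : (p.+1 + 0.*2.+1 = p.+2)%N by lia.
  rewrite peak_downSS letwE peak_down_anti // -[X in wt X](addn0 p.+1) wordw_iota_anti.
  by rewrite !addn0 /= !exprS; ring.
have -> : (p.+1 + k.+1.*2.+1 = (p + k.*2.+1).+1.+2)%N by lia.
rewrite peak_downSS letw_exc; last by lia.
have -> : ((p + k.*2.+1).+2 = p.+2 + k.*2.+1)%N by lia.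
rewrite IHk -[X in wt X](addn0 p.+1) wordw_iota_anti geoSr.
have -> : (p.+1 + k.+1 = p.+2 + k)%N by lia.
by rewrite -addnn !(exprS, exprD); ring.
Qed.

Lemma peak_false0_even k : peak false 0 k.+1.*2 =
  q ^+ k.+1 * k.+1%:R * y ^+ k.+1 + q * y ^+ k.+2 * geo k + x ^+ k.+1.*2.
Proof.
rewrite doubleS peak_downSS letw_exc // (wordw_iota 0) (peak_false_even 0 k) add1n.
by rewrite !exprS; ring.
Qed.

Lemma peak_false0_odd k : peak false 0 k.+1.*2.+1 =
  q ^+ k.+1 * (k.+1%:R * x * y ^+ k.+1 + y ^+ k.+2) + q * y ^+ k.+3 * geo k + x ^+ k.+1.*2.+1.
Proof.
rewrite doubleS peak_downSS letw_exc // (wordw_iota 0) -doubleS.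
rewrite (peak_false_odd 0 k : peak false 1 k.*2.+2 = _) add1n !exprS; ring.
Qed.

Lemma peak_iotaSS p n (c : bool) : sumw p (peak_words c (iota p n.+2)) =
  x * sumw p.+1 (peak_words c (iota p.+1 n.+1)) + (if c then q * y ^+ n.+1 else dec n.+2).
Proof.
rewrite peak_words_cons sumw_cat sumw_cons letwE [X in _ + X]sumw1; congr (_ + _).
case: c; last by rewrite /swing -[RHS](wordw_down p) down_rev.
rewrite -[p :: _]/(iota p n.+2) -addn1 iotaD cats1 swing_rcons wordw_cons letw_exc;
  rewrite ?(wordw_iota_anti 0) //.
by rewrite addnS ltnS leq_addr.
Qed.

Lemma peak_iota_shift (c : bool) p n :
  sumw p (peak_words c (iota p n.+1)) = sumw 0 (peak_words c (iota 0 n.+1)).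
Proof.
elim: n p => [|n IHn] p; first by rewrite !sumw1 /= !letwE.
by rewrite !peak_iotaSS IHn [in RHS]IHn.
Qed.

Lemma decSS n : dec n.+2 = q * y * dec n.
Proof. by rewrite /dec /= negbK exprS mulrCA. Qed.

(** A rotation of a decreasing word consists of two decreasing words, each on its own positions. *)
Lemma rot_down n :
  sumw 0 (rot_words (down 0 n.+1)) = \sum_(k < n.+1) dec (n.+1 - k) * dec k.
Proof.
rewrite /sumw big_map size_down -[iota _ _]/(index_iota 0 n.+1) big_mkord.
apply: eq_bigr => k _; have le_kn : (k <= n.+1)%N by apply: ltnW.
have -> : down 0 n.+1 = down (n.+1 - k) k ++ down 0 (n.+1 - k)
  by rewrite -[in LHS](subnK le_kn) down_cat.
by rewrite -[X in rot X](size_down (n.+1 - k) k) rot_size_cat wordw_cat size_down !wordw_down.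
Qed.

Lemma rot_downSS n : sumw 0 (rot_words (down 0 n.+3)) =
  q * y * sumw 0 (rot_words (down 0 n.+1)) + q * y * dec n.+1 + x * dec n.+2.
Proof.
rewrite !rot_down !big_ord_recr /=.
have -> : (n.+3 - n = 3)%N by lia.
have -> : (n.+3 - n.+1 = 2)%N by lia.
have -> : (n.+3 - n.+2 = 1)%N by lia.
have -> : (n.+1 - n = 1)%N by lia.
rewrite (decSS 1) (decSS 0) mulrDr !mulrA; congr (_ + _ + _ + _).
- rewrite mulr_sumr; apply: eq_bigr => k _.
  have lt_kn := ltn_ord k; rewrite mulrA -decSS; congr (dec _ * _); lia.
- by rewrite /dec /=; ring.
by rewrite /dec /=; ring.
Qed.

Lemma rot_iota n : sumw 0 (rot_words (iota 0 n.+1)) = x ^+ n.+1 + q * y * geo n.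
Proof.
have -> : rot_words (iota 0 n.+1) = [seq rot k (iota 0 n.+1) | k <- index_iota 0 n.+1].
  by rewrite /rot_words size_iota.
rewrite /sumw big_map big_mkord.
rewrite big_ord_recl rot0 (wordw_iota 0); congr (_ + _).
(* Rotation by k + 1 places n - k letters above their positions and the other k + 1 below; n - k > 0
   keeps the latter from being fixed. *)
transitivity (\sum_(k < n) q ^+ (n - k) * y ^+ k.+1).
  apply: eq_bigr => k _; rewrite lift0.
  have lt_kn := ltn_ord k.
  have -> : iota 0 n.+1 = iota 0 k.+1 ++ iota k.+1 (n - k).
    by rewrite -(iotaD 0); congr iota; lia.
  rewrite -[X in rot X](size_iota 0 k.+1) rot_size_cat wordw_cat size_iota.
  have := wordw_iota k.+1 0 (n - k); rewrite addn0 => ->; congr (_ * _).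
  case: (n - k)%N (subn_gt0 k n) => [|m]; first by rewrite lt_kn.
  by have := wordw_iota_anti m 0 k.+1; rewrite addn0.
elim: n => [|n IHn]; first by rewrite big_ord0 /= mulr0.
rewrite big_ord_recr geoSr /= subSnn mulrDr addrC; congr (_ + _).
  by rewrite !exprS expr0; ring.
rewrite mulrCA -IHn mulr_sumr; apply: eq_bigr => k _.
by rewrite mulrA -exprS subSn // ltnW.
Qed.

End WordWeights.

(** * Generating functions *)

Lemma parity_ind (P : nat -> Prop) :
  (forall k, P k.*2) -> (forall k, P k.*2.+1) -> forall n, P n.
Proof. by move=> Pe Po n; rewrite -(odd_double_half n); case: (odd n); [apply: Po | apply: Pe]. Qed.

Section Series.
Variable R : comNzRingType.
Implicit Types (ps qs : seq R) (f : nat -> R).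

(* Stops at the last element of [qs], so that it reduces for symbolic [n]. *)
Fixpoint conv qs f n : R :=
  if qs is c :: qs' then
    c * f n + (if nilp qs' then 0 else if n is n'.+1 then conv qs' f n' else 0)
  else 0.

Lemma convE qs f n : conv qs f n = \sum_(i < n.+1) qs`_i * f (n - i)%N.
Proof.
elim: qs n => [|c qs IHqs] n /=.
  by rewrite big1 // => i _; rewrite nth_nil mul0r.
rewrite big_ord_recl subn0; congr (_ + _); case: nilP => [->|_].
  by rewrite big1 // => i _; rewrite lift0 /= nth_nil mul0r.
by case: n => [|n]; rewrite ?big_ord0 // IHqs.
Qed.

Lemma ratseries_conv ps qs f :
  (forall n, conv (1 :: qs) f n = ps`_n) -> f =1 ratseries (Poly ps) (Poly (1 :: qs)).
Proof.
move=> f_conv; apply/ratseriesP => [|n]; first by rewrite coef_Poly.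
rewrite coef_Poly -f_conv convE.
by apply: eq_bigr => i _; rewrite coef_Poly.
Qed.

End Series.

Section GeneratingFunctions.
Variables (R : comNzRingType) (x q y : R).
Local Notation Fw := (Fw x q y).

(** With t = q y z^2 the denominator is (1 + t)(1 - 3t + t^2), the recurrence of products of two
    Fibonacci numbers: its ratios are the squares of the two Fibonacci roots and their product
    -1. *)
Lemma gf_123_132_213 :
  Fw [set p123; p132; p213] =1
  ratseries (Poly [:: 1; x; x ^+ 2 - q * y; - (x * q * y) + q ^+ 2 * y + q * y ^+ 2;
                      - (x ^+ 2 * q * y)])
    (Poly [:: 1; 0; - (2 * q * y); 0; - (2 * q ^+ 2 * y ^+ 2); 0; q ^+ 3 * y ^+ 3]).
Proof.
apply: ratseries_conv.
have fe k := etrans (Fw_123_132_213 x q y k.*2) (far_down_even x q y 0 k).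
have fo k := etrans (Fw_123_132_213 x q y k.*2.+1) (far_down_odd x q y 0 k).
move: (Fw _) fe fo => f fe fo.
have f0 := fe 0%N; have f1 := fo 0%N; have f2 := fe 1%N; have f3 := fo 1%N.
have f4 := fe 2%N; have f5 := fo 2%N; have f6 := fe 3%N.
(* Length 6 is split off too, so that all even lengths in the general case are at least 2 and no
   truncated [k.-1] remains. *)
case=> [|[|[|[|[|[|[|n]]]]]]];
  try by rewrite /= ?f0 ?f1 ?f2 ?f3 ?f4 ?f5 ?f6 /fib /= ?(exprS, expr0); ring.
elim/parity_ind: n => k /=; rewrite ?nth_nil -!doubleS !(fe, fo) !add0n /=.
  rewrite !fibSS !natrD ?(exprS, expr0). ring.
rewrite !fibSS !natrD ?(exprS, expr0). ring.
Qed.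


Lemma gf_231_312_321 :
  Fw [set p231; p312; p321] =1 ratseries (Poly [:: 1]) (Poly [:: 1; - x; - (q * y)]).
Proof.
apply: ratseries_conv => n.
have f0 := etrans (Fw_231_312_321 x q y 0) (far_iota0 x q y 0).
have f1 := etrans (Fw_231_312_321 x q y 1) (far_iota1 x q y 0).
have fSS m := etrans (Fw_231_312_321 x q y m.+2) (far_iotaSS x q y 0 m).
have {}fSS m : Fw [set p231; p312; p321] m.+2 =
    x * Fw [set p231; p312; p321] m.+1 + q * y * Fw [set p231; p312; p321] m.
  by rewrite fSS !Fw_231_312_321; congr (_ * _ + _ * _); apply: far_iota_shift.
move: (Fw _) f0 f1 fSS => f f0 f1 fSS.
by case: n => [|[|n]]; rewrite /= ?fSS ?f1 ?f0 ?nth_nil; ring.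
Qed.

Lemma gf_123_213_231 :
  Fw [set p123; p213; p231] =1
  ratseries (Poly [:: 1; x; x ^+ 2 - q * y; q * y ^+ 2;
                      - (x ^+ 2 * q * y) + x * q * y ^+ 2 + q ^+ 2 * y ^+ 2])
    (Poly [:: 1; 0; - (2 * q * y); 0; q ^+ 2 * y ^+ 2]).
Proof.
apply: ratseries_conv.
have f0 := etrans (Fw_123_213_231 x q y 0) (sumw1 x q y 0 [::]).
have f1 := etrans (Fw_123_213_231 x q y 1) (sumw1 x q y 0 [:: 0%N]).
have fe k := etrans (Fw_123_213_231 x q y k.+1.*2) (peak_true0_even x q y k).
have fo k := etrans (Fw_123_213_231 x q y k.+1.*2.+1) (peak_true0_odd x q y k).
move: (Fw _) f0 f1 fe fo => f f0 f1 fe fo.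
have f2 := fe 0%N; have f3 := fo 0%N; have f4 := fe 1%N; have f5 := fo 1%N.
(* The closed forms begin at length 2 and the recurrence reaches back four places, so lengths up to
   5 are checked separately. *)
case=> [|[|[|[|[|[|n]]]]]];
  try by rewrite /= ?f0 ?f1 ?f2 ?f3 ?f4 ?f5 /= ?letwE ?(exprS, expr0); ring.
elim/parity_ind: n => k; rewrite /= ?nth_nil -!doubleS !(fe, fo) ?(exprMn, exprS, expr0); ring.
Qed.

Lemma gf_213_231_321 :
  Fw [set p213; p231; p321] =1
  ratseries (Poly [:: 1; - y; q * y]) (Poly [:: 1; - (x + y); x * y]).
Proof.
apply: ratseries_conv.
have f0 := etrans (Fw_213_231_321 x q y 0) (sumw1 x q y 0 [::]).
have f1 := etrans (Fw_213_231_321 x q y 1) (sumw1 x q y 0 [:: 0%N]).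
have fSS n := etrans (Fw_213_231_321 x q y n.+2) (peak_iotaSS x q y 0 n true).
have {}fSS n : Fw [set p213; p231; p321] n.+2 =
    x * Fw [set p213; p231; p321] n.+1 + q * y ^+ n.+1.
  by rewrite fSS Fw_213_231_321; congr (_ * _ + _); apply: peak_iota_shift.
move: (Fw _) f0 f1 fSS => f f0 f1 fSS.
case=> [|[|[|n]]]; rewrite /= ?fSS ?f0 ?f1 /= ?letwE ?nth_nil ?(exprS, expr0); ring.
Qed.

(** The denominator is (1 - xz)(1 - yz)(1 - q y z^2)^2 expanded: the first factor comes from the
    powers of x, the second from the powers of y in [geo] taken at both parities, the square from
    the terms k (q y)^k. *)
Lemma gf_132_213_231 :
  Fw [set p132; p213; p231] =1
  ratseries (Poly [:: 1; - y; - (q * y); 2 * q * y ^+ 2;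
                      - (x ^+ 2 * q * y) + q ^+ 2 * y ^+ 2 - x * q * y ^+ 2;
                      x ^+ 2 * q * y ^+ 2 - 2 * q ^+ 2 * y ^+ 3; x * q ^+ 2 * y ^+ 3])
    (Poly [:: 1; - (x + y); x * y - 2 * q * y; 2 * q * y * (x + y);
              q ^+ 2 * y ^+ 2 - 2 * q * y * (x * y); - (q ^+ 2 * y ^+ 2 * (x + y));
              q ^+ 2 * y ^+ 2 * (x * y)]).
Proof.
apply: ratseries_conv.
have f0 := etrans (Fw_132_213_231 x q y 0) (sumw1 x q y 0 [::]).
have f1 := etrans (Fw_132_213_231 x q y 1) (sumw1 x q y 0 [:: 0%N]).
have fe k := etrans (Fw_132_213_231 x q y k.+1.*2) (peak_false0_even x q y k).
have fo k := etrans (Fw_132_213_231 x q y k.+1.*2.+1) (peak_false0_odd x q y k).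
move: (Fw _) f0 f1 fe fo => f f0 f1 fe fo.
have f2 := fe 0%N; have f3 := fo 0%N; have f4 := fe 1%N; have f5 := fo 1%N.
have f6 := fe 2%N; have f7 := fo 2%N.
case=> [|[|[|[|[|[|[|[|n]]]]]]]];
  try by rewrite /= ?f0 ?f1 ?f2 ?f3 ?f4 ?f5 ?f6 ?f7 /= ?letwE ?(exprS, expr0); ring.
elim/parity_ind: n => k; rewrite /= ?nth_nil -!doubleS !(fe, fo) !geoS ?doubleS ?(exprS, expr0); ring.
Qed.

Lemma gf_213_231_312 :
  Fw [set p213; p231; p312] =1
  ratseries (Poly [:: 1; 0; 0; x * q * y]) (Poly [:: 1; - x; - (q * y); x * q * y]).
Proof.
apply: ratseries_conv.
have f0 := etrans (Fw_213_231_312 x q y 0) (sumw1 x q y 0 [::]).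
have f1 := etrans (Fw_213_231_312 x q y 1) (sumw1 x q y 0 [:: 0%N]).
have fSS n := etrans (Fw_213_231_312 x q y n.+2) (peak_iotaSS x q y 0 n false).
have {}fSS n : Fw [set p213; p231; p312] n.+2 =
    x * Fw [set p213; p231; p312] n.+1 + dec x q y n.+2.
  by rewrite fSS Fw_213_231_312; congr (_ * _ + _); apply: peak_iota_shift.
move: (Fw _) f0 f1 fSS => f f0 f1 fSS.
case=> [|[|[|[|n]]]]; rewrite /= ?fSS ?f0 ?f1 /= ?letwE ?nth_nil ?(decSS _ _ _ n.+2) ?(decSS _ _ _ n.+1).
- ring.
- ring.
- rewrite /dec /=; ring.
- rewrite /dec /=; ring.
ring.
Qed.

Lemma gf_123_231_312 :
  Fw [set p123; p231; p312] =1
  ratseries (Poly [:: 1; x; x ^+ 2 - q * y; x * q * y; q ^+ 2 * y ^+ 2])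
    (Poly [:: 1; 0; - (2 * q * y); 0; q ^+ 2 * y ^+ 2]).
Proof.
apply: ratseries_conv.
have f0 := etrans (Fw_123_231_312 x q y 0) (sumw1 x q y 0 [::]).
have f1 := etrans (Fw_123_231_312 x q y 1) (rot_down x q y 0).
have f2 := etrans (Fw_123_231_312 x q y 2) (rot_down x q y 1).
have fS n := etrans (Fw_123_231_312 x q y n.+3) (rot_downSS x q y n).
have {}fS n : Fw [set p123; p231; p312] n.+3 =
    q * y * Fw [set p123; p231; p312] n.+1 + q * y * dec x q y n.+1 + x * dec x q y n.+2.
  by rewrite fS !Fw_123_231_312.
move: (Fw _) f0 f1 f2 fS => f f0 f1 f2 fS.
rewrite !big_ord_recr !big_ord0 /= in f1 f2.
case=> [|[|[|[|[|n]]]]]; rewrite /= ?nth_nil !(fS, f1, f2, f0) ?decSS /dec /=; ring.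
Qed.

(** By [rot_iota] the sum combines geometric sequences of ratios x, q and y, and the denominator is
    the product of the three factors. *)
Lemma gf_132_213_321 :
  Fw [set p132; p213; p321] =1
  ratseries (Poly [:: 1; - (y + q); 2 * q * y; - (x * q * y)])
    (Poly [:: 1; - (x + y + q); x * y + x * q + y * q; - (x * y * q)]).
Proof.
apply: ratseries_conv.
have f0 := etrans (Fw_132_213_321 x q y 0) (sumw1 x q y 0 [::]).
have fS n := etrans (Fw_132_213_321 x q y n.+1) (rot_iota x q y n).
move: (Fw _) f0 fS => f f0 fS.
case=> [|[|[|[|n]]]]; rewrite /= ?fS ?f0 /= ?nth_nil ?(exprS, expr0); ring.
Qed.

End GeneratingFunctions.

(** * Pattern sets that contain 123 and 321 *)

Lemma Fw_monotone_large (R : comNzRingType) (x q y : R) (s1 s2 s3 : seq nat) n :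
    all (fun s => perm_eq s (iota 1 3)) [:: s1; s2; s3] ->
  [:: 1; 2; 3]%N \in [:: s1; s2; s3] ->
  [:: 3; 2; 1]%N \in [:: s1; s2; s3] -> (4 < n)%N ->
  Fw x q y [set oneline 2 s1; oneline 2 s2; oneline 2 s3] n = 0.
Proof.
move=> s_perm s123 s321 lt_4n; rewrite Fw_permutations // big_seq big1 // => w.
rewrite mem_filter mem_permutations => /andP[w_good w_perm].
have patM a b c s : s \in [:: s1; s2; s3] -> pat s a b c -> pat3 s1 s2 s3 a b c.
  by rewrite !inE /pat3 => /or3P[] /eqP<- ->; rewrite ?orbT.
have monoP a b c : (a < b < c)%N || (c < b < a)%N -> pat3 s1 s2 s3 a b c.
  move=> /orP[] /andP[lt_ab lt_bc]; [apply: patM s123 _ | apply: patM s321 _];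
    by rewrite /pat /=; lia.
have := monotone_triple monoP.
move=> /(_ w); rewrite w_good (perm_uniq w_perm) iota_uniq (perm_size w_perm) size_iota.
by rewrite lt_4n => /(_ isT isT).
Qed.

Section FiniteGeneratingFunctions.
Variables (R : comNzRingType) (x q y : R).
Local Notation Fw := (Fw x q y).

Ltac enumerate_small :=
  case=> [|[|[|[|[|n]]]]]; last (by rewrite Fw_monotone_large // nth_default);
  rewrite Fw_permutations //;
  match goal with |- context [filter ?P ?s] =>
    let t := eval vm_compute in (filter P s) in change (filter P s) with t
  end; rewrite unlock /= /letw /=; ring.

Lemma gf_123_132_321 :
  Fw [set p123; p132; p321] =1
  nth 0 [:: 1; x; x ^+ 2 + q * y; x * q * y + q ^+ 2 * y + q * y ^+ 2; q ^+ 2 * y ^+ 2].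
Proof. enumerate_small. Qed.

Lemma gf_123_213_321 :
  Fw [set p123; p213; p321] =1
  nth 0 [:: 1; x; x ^+ 2 + q * y; x * q * y + q ^+ 2 * y + q * y ^+ 2; q ^+ 2 * y ^+ 2].
Proof. enumerate_small. Qed.

Lemma gf_123_231_321 :
  Fw [set p123; p231; p321] =1
  nth 0 [:: 1; x; x ^+ 2 + q * y; 2 * x * q * y + q * y ^+ 2; q ^+ 2 * y ^+ 2].
Proof. enumerate_small. Qed.

Lemma gf_123_312_321 :
  Fw [set p123; p312; p321] =1
  nth 0 [:: 1; x; x ^+ 2 + q * y; 2 * x * q * y + q ^+ 2 * y; q ^+ 2 * y ^+ 2].
Proof. enumerate_small. Qed.

End FiniteGeneratingFunctions.

(** * Symmetries of the patterns *)

Lemma onelineV s t : perm_eq s (iota 1 3) -> perm_eq t (iota 1 3) ->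
  (forall i, (i < 3)%N -> nth 0%N t (nth 0%N s i).-1 = i.+1) ->
  (oneline 2 s)^-1%g = oneline 2 t.
Proof.
move=> s_perm t_perm tsK; apply/eqP; rewrite eq_invg_mul; apply/eqP/permP => i.
rewrite permM perm1; apply/ord_inj/succn_inj.
by rewrite onelineE // -[X in nth _ _ X]/(_.+1.-1) onelineE // tsK.
Qed.

Lemma onelineJ s t : perm_eq s (iota 1 3) -> perm_eq t (iota 1 3) ->
  (forall i, (i < 3)%N -> nth 0%N t i = 4 - nth 0%N s (2 - i))%N ->
  (oneline 2 s ^ revp 3)%g = oneline 2 t.
Proof.
move=> s_perm t_perm tE; apply/permP => i; apply/ord_inj/succn_inj.
rewrite revpJ [RHS]onelineE // tE // [in LHS]permE /=.
have -> : (2 - i)%N = revp 3 i by rewrite permE.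
by rewrite -onelineE // -subSn.
Qed.

Ltac by_letters lem := by apply: lem => // -[|[|[|]]].

Lemma p123V : p123^-1%g = p123. Proof. by_letters onelineV. Qed.
Lemma p132V : p132^-1%g = p132. Proof. by_letters onelineV. Qed.
Lemma p213V : p213^-1%g = p213. Proof. by_letters onelineV. Qed.
Lemma p231V : p231^-1%g = p312. Proof. by_letters onelineV. Qed.
Lemma p312V : p312^-1%g = p231. Proof. by_letters onelineV. Qed.
Lemma p321V : p321^-1%g = p321. Proof. by_letters onelineV. Qed.

Lemma p123J : (p123 ^ revp 3)%g = p123. Proof. by_letters onelineJ. Qed.
Lemma p132J : (p132 ^ revp 3)%g = p213. Proof. by_letters onelineJ. Qed.
Lemma p213J : (p213 ^ revp 3)%g = p132. Proof. by_letters onelineJ. Qed.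
Lemma p231J : (p231 ^ revp 3)%g = p312. Proof. by_letters onelineJ. Qed.
Lemma p312J : (p312 ^ revp 3)%g = p231. Proof. by_letters onelineJ. Qed.
Lemma p321J : (p321 ^ revp 3)%g = p321. Proof. by_letters onelineJ. Qed.

Definition patV := (p123V, p132V, p213V, p231V, p312V, p321V).
Definition patJ := (p123J, p132J, p213J, p231J, p312J, p321J).

Ltac poly_ring := rewrite /= !cons_poly_def; ring.

Theorem theorem5p1 :
  let x : {poly {mpoly int[2]}} := ('X_0)%:P in
  let q : {poly {mpoly int[2]}} := ('X_1)%:P in
  let z : {poly {mpoly int[2]}} := 'X in
  (* (a) *)
  (F [set p123; p132; p213] =1
     ratseries (1 + x * z + (x ^+ 2 - q) * z ^+ 2
                 + (- (x * q) + q ^+ 2 + q) * z ^+ 3 - x ^+ 2 * q * z ^+ 4)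
               ((1 + q * z ^+ 2)
                 * (1 - 3 * q * z ^+ 2 + q ^+ 2 * z ^+ 4))) /\
  (* (b) *)
  (F [set p231; p312; p321] =1 ratseries 1 (1 - x * z - q * z ^+ 2)) /\
  (* (c) *)
  (let C := ratseries (1 + x * z + (x ^+ 2 - q) * z ^+ 2 + q * z ^+ 3
                        + (- (x ^+ 2 * q) + x * q + q ^+ 2) * z ^+ 4)
                      ((1 - q * z ^+ 2) ^+ 2) in
   F [set p123; p132; p231] =1 C /\ F [set p123; p213; p231] =1 C) /\
  (* (c') *)
  (let C' := ratseries (1 + x * z + (x ^+ 2 - q) * z ^+ 2 + q ^+ 2 * z ^+ 3
                         + (- (x ^+ 2 * q) + x * q ^+ 2 + q ^+ 2) * z ^+ 4)
                       ((1 - q * z ^+ 2) ^+ 2) in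
   F [set p123; p132; p312] =1 C' /\ F [set p123; p213; p312] =1 C') /\
  (* (d) *)
  (let D := ratseries (1 - z + q * z ^+ 2) ((1 - z) * (1 - x * z)) in
   F [set p132; p231; p321] =1 D /\ F [set p213; p231; p321] =1 D) /\
  (* (d') *)
  (let D' := ratseries (1 - q * z + q * z ^+ 2)
                       ((1 - x * z) * (1 - q * z)) in
   F [set p132; p312; p321] =1 D' /\ F [set p213; p312; p321] =1 D') /\
  (* (e) *)
  (F [set p132; p213; p231] =1
     ratseries (1 - z - q * z ^+ 2 + 2 * q * z ^+ 3
                 + (- (x ^+ 2 * q) + q ^+ 2 - x * q) * z ^+ 4
                 + (x ^+ 2 * q - 2 * q ^+ 2) * z ^+ 5
                 + x * q ^+ 2 * z ^+ 6)
               ((1 - z) * (1 - x * z) * (1 - q * z ^+ 2) ^+ 2)) /\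
  (* (e') *)
  (F [set p132; p213; p312] =1
     ratseries (1 - q * z - q * z ^+ 2 + 2 * q ^+ 2 * z ^+ 3
                 + (- (x ^+ 2 * q) - x * q ^+ 2 + q ^+ 2) * z ^+ 4
                 + (x ^+ 2 * q ^+ 2 - 2 * q ^+ 3) * z ^+ 5
                 + x * q ^+ 3 * z ^+ 6)
               ((1 - x * z) * (1 - q * z) * (1 - q * z ^+ 2) ^+ 2)) /\
  (* (f) *)
  (let G := ratseries (1 + x * q * z ^+ 3)
                      ((1 - x * z) * (1 - q * z ^+ 2)) in
   F [set p132; p231; p312] =1 G /\ F [set p213; p231; p312] =1 G) /\
  (* (g) *)
  (F [set p123; p231; p312] =1
     ratseries (1 + x * z + (x ^+ 2 - q) * z ^+ 2 + x * q * z ^+ 3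
                 + q ^+ 2 * z ^+ 4)
               ((1 - q * z ^+ 2) ^+ 2)) /\
  (* (h) *)
  (F [set p132; p213; p321] =1
     ratseries (1 - (1 + q) * z + 2 * q * z ^+ 2 - x * q * z ^+ 3)
               ((1 - z) * (1 - x * z) * (1 - q * z))) /\
  (* (i) *)
  (let P := 1 + x * z + (x ^+ 2 + q) * z ^+ 2
            + (x * q + q ^+ 2 + q) * z ^+ 3 + q ^+ 2 * z ^+ 4 in
   F [set p123; p132; p321] =1 nth 0 P /\
   F [set p123; p213; p321] =1 nth 0 P) /\
  (* (j) *)
  (F [set p123; p231; p321] =1
     nth 0 (1 + x * z + (x ^+ 2 + q) * z ^+ 2 + (2 * x * q + q) * z ^+ 3
             + q ^+ 2 * z ^+ 4)) /\
  (* (j') *)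
  (F [set p123; p312; p321] =1
     nth 0 (1 + x * z + (x ^+ 2 + q) * z ^+ 2 + (2 * x * q + q ^+ 2) * z ^+ 3
             + q ^+ 2 * z ^+ 4)).
Proof.
(* One symmetry moves the variable q to the letters below their positions: the general series is
   then read at weights x, 1, q, which yields the primed formulas. *)
have swapV (s1 s2 s3 : 'S_3) n :
    F [set s1^-1; s2^-1; s3^-1]%g n = Fw 'X_0 1 'X_1 [set s1; s2; s3] n.
  by rewrite F_Fw FwV.
have swapJ (s1 s2 s3 : 'S_3) n : F [set s1 ^ revp 3; s2 ^ revp 3; s3 ^ revp 3]%g n =
    Fw 'X_0 1 'X_1 [set s1; s2; s3] n by rewrite F_Fw FwJ.
(* The two exchanges of q and y cancel, so the composite symmetry relates the pattern sets that
   share one formula. *)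
have swapVJ (s1 s2 s3 : 'S_3) n :
    F [set (s1 ^ revp 3)^-1; (s2 ^ revp 3)^-1; (s3 ^ revp 3)^-1]%g n =
    Fw 'X_0 'X_1 1 [set s1; s2; s3] n by rewrite swapV FwJ.
have coefP (s : seq {mpoly int[2]}) P n : Poly s = P -> nth 0 s n = P`_n.
  by move=> <-; rewrite coef_Poly.
have ratE P P' Q Q' n : P = P' -> Q = Q' ->
    @ratseries {mpoly int[2]} P Q n = ratseries P' Q' n by move=> -> ->.
cbv zeta.
split; first by move=> n; rewrite F_Fw gf_123_132_213; apply: ratE; poly_ring.
split; first by move=> n; rewrite F_Fw gf_231_312_321; apply: ratE; poly_ring.
split.
  split=> n.
    have := swapVJ p123 p213 p231 n; rewrite !(patJ, patV) gf_123_213_231 => ->.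
    by apply: ratE; poly_ring.
  by rewrite F_Fw gf_123_213_231; apply: ratE; poly_ring.
split.
  split=> n.
    have := swapJ p123 p213 p231 n; rewrite !patJ gf_123_213_231 => ->.
    by apply: ratE; poly_ring.
  have := swapV p123 p213 p231 n; rewrite !patV gf_123_213_231 => ->.
  by apply: ratE; poly_ring.
split.
  split=> n.
    have := swapVJ p213 p231 p321 n; rewrite !(patJ, patV) gf_213_231_321 => ->.
    by apply: ratE; poly_ring.
  by rewrite F_Fw gf_213_231_321; apply: ratE; poly_ring.
split.
  split=> n.
    have := swapJ p213 p231 p321 n; rewrite !patJ gf_213_231_321 => ->.
    by apply: ratE; poly_ring.
  have := swapV p213 p231 p321 n; rewrite !patV gf_213_231_321 => ->.
  by apply: ratE; poly_ring.
split; first by move=> n; rewrite F_Fw gf_132_213_231; apply: ratE; poly_ring.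
split.
  move=> n; have := swapV p132 p213 p231 n; rewrite !patV gf_132_213_231 => ->.
  by apply: ratE; poly_ring.
split.
  split=> n.
    have := swapVJ p213 p231 p312 n; rewrite !(patJ, patV) gf_213_231_312 => ->.
    by apply: ratE; poly_ring.
  by rewrite F_Fw gf_213_231_312; apply: ratE; poly_ring.
split; first by move=> n; rewrite F_Fw gf_123_231_312; apply: ratE; poly_ring.
split; first by move=> n; rewrite F_Fw gf_132_213_321; apply: ratE; poly_ring.
split.
  split=> n; first by rewrite F_Fw gf_123_132_321; apply: coefP; poly_ring.
  by rewrite F_Fw gf_123_213_321; apply: coefP; poly_ring.
split=> n; first by rewrite F_Fw gf_123_231_321; apply: coefP; poly_ring.
by rewrite F_Fw gf_123_312_321; apply: coefP; poly_ring.
Qed.
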